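(* Let $n,N,j$ be integers with $0\leq j\leq n-1$ and $N\geq n+1$. There exists a constant $c_{n,N,j}>0$, depending only on $n,N$ and $j$, such that for every centrally symmetric convex body $K$ in $\mathbb{R}^n$, $$c_{n,N,j}\,|K|^N\,W_j(K)\leq\int_{K}\cdots\int_{K}W_j(\mathrm{conv}\{x_1,\ldots ,x_N\})\,dx_N\cdots dx_1.$$
   Context: A convex body in $\mathbb{R}^n$ is a compact convex set with non-empty interior; it is centrally symmetric if $x\in K$ implies $-x\in K$. $|\cdot|$ denotes volume and $B_2^n$ is the Euclidean unit ball of $\mathbb{R}^n$. For a non-empty compact convex set $L\subset\mathbb{R}^n$, the quermassintegrals $W_0(L),\ldots,W_n(L)$ are defined by Steiner's formula $|L+\lambda B_2^n|=\sum_{i=0}^n\binom{n}{i}W_i(L)\lambda^i$ for $\lambda\geq 0$; equivalently $W_i(L)$ is the mixed volume of $n-i$ copies of $L$ and $i$ copies of $B_2^n$. *)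

(* Defs.v *)
From HB Require Import structures.
From mathcomp Require Import all_boot all_order all_algebra.
From mathcomp Require Import all_classical all_reals all_analysis.

Set Implicit Arguments.
Unset Strict Implicit.
Unset Printing Implicit Defensive.

Import Order.TTheory GRing.Theory Num.Theory.
Import numFieldNormedType.Exports.

Local Open Scope classical_set_scope.
Local Open Scope ring_scope.

(* The library has no Lebesgue measure in dimension n > 1: it is built here on
   n.-tuple R by iterating the binary product measure, and then transported to
   'rV[R]_n with its Borel sigma-algebra. *)
Section lebesgue_tuple.
Context {R : realType}.
Local Notation T := (measurableTypeR R).

Definition cons_pair n (p : T * n.-tuple T) : n.+1.-tuple T :=
  [tuple of p.1 :: p.2].

Lemma measurable_cons_pair n :
  measurable_fun [set: T * n.-tuple T] (@cons_pair n).
Proof. exact: measurable_cons measurable_fst measurable_snd. Qed.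

Section step.
Context (n : nat) (mu : {sigma_finite_measure set (n.-tuple T) -> \bar R}).

Definition cons_measure : set (n.+1.-tuple T) -> \bar R :=
  pushforward (lebesgue_measure \x mu)%E (@cons_pair n).

Let cons_measure0 : cons_measure set0 = 0%E.
Proof. by rewrite /cons_measure /pushforward preimage_set0 measure0. Qed.

Let cons_measure_ge0 A : (0 <= cons_measure A)%E.
Proof. by rewrite /cons_measure /pushforward measure_ge0. Qed.

Let cons_measure_sigma_additive : semi_sigma_additive cons_measure.
Proof.
have mC A : measurable A -> measurable (@cons_pair n @^-1` A).
  by move=> mA; rewrite -[X in measurable X]setTI; exact: measurable_cons_pair.
move=> F mF tF mUF; rewrite /cons_measure /pushforward preimage_bigcup.
apply: measure_semi_sigma_additive.
- by move=> k; exact: mC.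
- apply/trivIsetP => /= i j _ _ ij; rewrite -preimage_setI.
  by move/trivIsetP : tF => /(_ _ _ _ _ ij) ->//; rewrite preimage_set0.
- by rewrite -preimage_bigcup; exact: mC.
Qed.

HB.instance Definition _ := isMeasure.Build _ _ _ cons_measure
  cons_measure0 cons_measure_ge0 cons_measure_sigma_additive.

Let cons_measure_sigma_finite :
  sigma_finite [set: n.+1.-tuple T] cons_measure.
Proof.
have /sigma_finiteP[F [TF ndF Foo]] := sigma_finiteT (@lebesgue_measure R).
have /sigma_finiteP[G [TG ndG Goo]] := sigma_finiteT mu.
pose uncons (t : n.+1.-tuple T) : T * n.-tuple T :=
  (thead t, [tuple of behead t]).
have munc : measurable_fun setT uncons.
  apply: measurable_fun_pair; first exact: measurable_tnth.
  exact: measurable_behead.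
exists (fun k => uncons @^-1` (F k `*` G k)).
  rewrite -preimage_bigcup (_ : \bigcup_k _ = setT) ?preimage_setT//.
  rewrite -setXTT TF TG predeqE => -[x y]; split.
    by move=> [k _ []/= ? ?]; split; exists k.
  move=> [/= [k _ Fkx] [l _ Gly]]; exists (maxn k l) => //; split.
  - by move: x Fkx; exact/subsetPset/ndF/leq_maxl.
  - by move: y Gly; exact/subsetPset/ndG/leq_maxr.
move=> k; have [mFk Fk] := Foo k; have [mGk Gk] := Goo k; split.
  by rewrite -[X in measurable X]setTI; apply: munc => //; exact: measurableX.
rewrite /cons_measure /pushforward -comp_preimage (_ : _ \o _ = id).
  rewrite preimage_id product_measure1E//.
  by rewrite lte_mul_pinfty// ge0_fin_numE.
apply/funext => -[x t]/=; rewrite /uncons /cons_pair/=; congr pair.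
by apply/val_inj.
Qed.

HB.instance Definition _ := Measure_isSigmaFinite.Build _ _ _ cons_measure
  cons_measure_sigma_finite.

End step.

Fixpoint lebesgue_tuple n : {sigma_finite_measure set (n.-tuple T) -> \bar R} :=
  match n with
  | 0 => \d_([tuple] : 0.-tuple T)
  | n'.+1 => cons_measure (lebesgue_tuple n')
  end.

Lemma lebesgue_tuple_box n (A : 'I_n -> set T) :
  (forall i, measurable (A i)) ->
  lebesgue_tuple n [set t | forall i, A i (tnth t i)] =
  (\prod_(i < n) lebesgue_measure (A i))%E.
Proof.
elim: n A => [|n IHn] A mA /=.
  by rewrite big_ord0 diracE mem_set// => -[].
rewrite big_ord_recl -IHn => [|i]; last exact: mA.
rewrite /cons_measure /pushforward -product_measure1E//.
  congr (_ _); apply/seteqP; split=> -[x t]/=.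
    move=> At; split=> [|i]; first exact: (At ord0).
    by have := At (lift ord0 i); rewrite tnthS.
  by move=> [Ax At] i; case: (unliftP ord0 i) => [k ->|->//]; rewrite tnthS.
rewrite (_ : mkset _ = \big[setI/setT]_(i < n) ((@tnth n T ^~ i) @^-1`
    A (lift ord0 i))).
  apply: bigsetI_measurable => i _; rewrite -[X in measurable X]setTI.
  by apply: measurable_tnth => //; exact: mA.
rewrite -bigcap_seq; apply/seteqP; split => t /= At.
  by move=> i _; exact: At.
by move=> i; apply: At; rewrite /= mem_index_enum.
Qed.

End lebesgue_tuple.

Definition rVBorel (R : realType) (n : nat) :=
  g_sigma_algebraType (@open 'rV[R]_n).

Section lebesgue_rV.
Context {R : realType} (n : nat).
Local Notation T := (measurableTypeR R).

Definition row_of_tuple (t : n.-tuple T) : rVBorel R n :=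
  \row_(i < n) (tnth t i : R).

Lemma measurable_row_of_tuple : measurable_fun [set: n.-tuple T] row_of_tuple.
Proof.
apply: (@measurability _ _ _ _ _ row_of_tuple (@open 'rV[R]_n)) => // _ [U oU <-]; rewrite setTI.
pose box (q : n.-tuple (rat * rat)) : set (n.-tuple T) :=
  [set t | forall i, (tnth t i : R) \in
     `](ratr (tnth q i).1 : R), ratr (tnth q i).2[].
pose Q := [set q | box q `<=` row_of_tuple @^-1` U].
have mbox q : measurable (box q).
  rewrite (_ : box q = \big[setI/setT]_(i < n) ((@tnth n T ^~ i) @^-1`
      [set` `](ratr (tnth q i).1 : R), ratr (tnth q i).2[])).
    apply: bigsetI_measurable => i _; rewrite -[X in measurable X]setTI.
    by apply: measurable_tnth => //; exact: measurable_itv.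
  rewrite -bigcap_seq; apply/seteqP; split => t /= tq.
    by move=> i _; exact: tq.
  by move=> i; apply: tq; rewrite /= mem_index_enum.
rewrite (_ : _ @^-1` U = \bigcup_q (if `[< Q q >] then box q else set0)).
  apply: countable_bigcupT_measurable => [|q]; first exact: countableP.
  by case: ifP.
apply/seteqP; split=> [t Ut|t [q _]]; last by case: asboolP => // Qq /Qq.
have /nbhs_ballP[e /= e0 teU] : nbhs (row_of_tuple t : 'rV[R]_n) U.
  by move: oU; rewrite openE => /(_ _ Ut).
have exq (i : 'I_n) : exists q : rat * rat,
    [/\ tnth t i - e < ratr q.1 :> R, (ratr q.1 : R) < tnth t i,
        tnth t i < ratr q.2 :> R & (ratr q.2 : R) < tnth t i + e].
  have /rat_in_itvoo[a] : tnth t i - e < tnth t i by rewrite ltrBlDr ltrDl.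
  have /rat_in_itvoo[b] : tnth t i < tnth t i + e by rewrite ltrDl.
  by rewrite !in_itv/= => /andP[? ?] /andP[? ?]; exists (a, b).
have [q qP] := choice exq.
exists [tuple q i | i < n] => //; case: asboolP => [_|].
  by move=> i; rewrite tnth_mktuple in_itv/=; have [_ -> ->] := qP i.
case=> s sq; apply: teU; split=> // k i; rewrite !mxE /ball/=.
have := sq i; rewrite tnth_mktuple in_itv/= => /andP[q1s sq2].
have [q1 _ _ q2] := qP i; rewrite ltr_distlC; apply/andP; split.
  exact: lt_trans q1 q1s.
exact: lt_trans sq2 q2.
Qed.

Definition lebesgue_rV : set (rVBorel R n) -> \bar R :=
  pushforward (@lebesgue_tuple R n) row_of_tuple.

Let lebesgue_rV0 : lebesgue_rV set0 = 0%E.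
Proof. by rewrite /lebesgue_rV /pushforward preimage_set0 measure0. Qed.

Let lebesgue_rV_ge0 A : (0 <= lebesgue_rV A)%E.
Proof. by rewrite /lebesgue_rV /pushforward measure_ge0. Qed.

Let lebesgue_rV_sigma_additive : semi_sigma_additive lebesgue_rV.
Proof.
have mC A : measurable A -> measurable (row_of_tuple @^-1` A).
  by move=> mA; rewrite -[X in measurable X]setTI; exact: measurable_row_of_tuple.
move=> F mF tF mUF; rewrite /lebesgue_rV /pushforward preimage_bigcup.
apply: measure_semi_sigma_additive.
- by move=> k; exact: mC.
- apply/trivIsetP => /= i j _ _ ij; rewrite -preimage_setI.
  by move/trivIsetP : tF => /(_ _ _ _ _ ij) ->//; rewrite preimage_set0.
- by rewrite -preimage_bigcup; exact: mC.
Qed.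

HB.instance Definition _ := isMeasure.Build _ _ _ lebesgue_rV
  lebesgue_rV0 lebesgue_rV_ge0 lebesgue_rV_sigma_additive.

Lemma lebesgue_rV_box (A : 'I_n -> set (measurableTypeR R)) :
  (forall i, measurable (A i)) ->
  lebesgue_rV [set x : 'rV[R]_n | forall i, A i (x 0 i)] =
  (\prod_(i < n) lebesgue_measure (A i))%E.
Proof.
move=> mA; rewrite -lebesgue_tuple_box// /lebesgue_rV /pushforward.
congr (_ _); apply/seteqP; split=> t /= At i; have := At i.
  by rewrite mxE.
by rewrite mxE.
Qed.

End lebesgue_rV.

Section convex_geometry.
Context {R : realType} {n : nat}.
Local Notation V := 'rV[R]_n.
Implicit Types (K L : set V) (x : V).

Definition volume K : \bar R := lebesgue_rV (K : set (rVBorel R n)).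

(* The topology of 'rV[R]_n is that of the sup norm, hence the Euclidean one,
   but the balls of the library are cubes. *)
Definition euclidean_ball : set V := [set x | \sum_(i < n) x 0 i ^+ 2 <= 1].

Definition convex_body K := [/\ compact K, convex_set K & K° !=set0].

Definition centrally_symmetric K := forall x, K x -> K (- x).

Definition convex_hull (A : set V) : set V := smallest (@convex_set R V) A.

Definition parallel_body L (lambda : R) : set V :=
  [set x + lambda *: b | x in L & b in euclidean_ball].

Definition steiner_formula L (W : nat -> R) := forall lambda : R, 0 <= lambda ->
  volume (parallel_body L lambda) =
  (\sum_(i < n.+1) 'C(n, i)%:R * W i * lambda ^+ i)%:E.

(* Steiner's formula determines W i for i <= n; the value is meaningful when L
   is non-empty, compact and convex. *)
Definition quermassintegral L (i : nat) : R :=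
  xget (fun=> 0) [set W | steiner_formula L W] i.

(* iterated_integral K N f =
     \int_K ... \int_K f (x_1, ..., x_N) dx_N ... dx_1 *)
Fixpoint iterated_integral K (N : nat) : (N.-tuple V -> \bar R) -> \bar R :=
  match N with
  | 0 => fun f => f [tuple]
  | N'.+1 => fun f =>
      \int[@lebesgue_rV R n]_(x in (K : set (rVBorel R n)))
        iterated_integral K (fun xs : N'.-tuple V => f [tuple of (x : V) :: xs])
  end%E.

End convex_geometry.

(* Main.v *)
(* The Euclidean ball is a limit of zonotopes.  For a convex body L, the volume of
   L + t[0, v] is affine in t >= 0, since the piece added between t and t + s is a
   translate of the piece added between 0 and s; its slope is again a monotone
   functional of L that is affine along segments.  Hence the volume of L + tZ is,
   for every zonotope Z, a polynomial in t whose coefficients are nonnegative and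
   monotone in L, and so is the volume of L + tB by passing to the limit.  Thus the
   W_j exist, are nonnegative, monotone and homogeneous of degree n - j.
   If K is symmetric and e_1, ..., e_n in K almost maximize the determinant, then
   the simplex with vertices p_0 = 0, p_i = e_i / 2 contains a translate of rK,
   with r depending only on n.  If x_i - p_i lies in (r/2)K for all i <= n, the
   convex hull of the x_i still contains a translate of (r/2)K, so its W_j is at
   least (r/2)^(n-j) W_j(K); and p_i + (r/2)K is contained in K and has volume
   (r/2)^n |K|. *)
Require Import Defs.
From mathcomp Require Import all_boot all_order all_algebra.
From mathcomp Require Import all_classical all_reals all_analysis.
From mathcomp Require Import measurable_realfun perm ring lra.

Set Implicit Arguments.
Unset Strict Implicit.
Unset Printing Implicit Defensive.

Import Order.TTheory GRing.Theory Num.Theory.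
Import numFieldNormedType.Exports.

Local Open Scope classical_set_scope.
Local Open Scope ring_scope.

(** * Zonotopes approximating the ball: a random walk estimate *)

Definition dot (R : realType) n (x y : 'rV[R]_n) : R :=
  \sum_(i < n) x 0 i * y 0 i.

Section dot.
Context {R : realType} {n : nat}.
Implicit Types (x y z : 'rV[R]_n) (a : R).

Lemma dotC x y : dot x y = dot y x.
Proof. by apply: eq_bigr => i _; rewrite mulrC. Qed.

Lemma dotDr x y z : dot x (y + z) = dot x y + dot x z.
Proof. by rewrite -big_split; apply: eq_bigr => i _; rewrite mxE mulrDr. Qed.

Lemma dotZr a x y : dot x (a *: y) = a * dot x y.
Proof. by rewrite mulr_sumr; apply: eq_bigr => i _; rewrite mxE mulrCA. Qed.

Lemma dotDl x y z : dot (x + y) z = dot x z + dot y z.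
Proof. by rewrite dotC dotDr !(dotC z). Qed.

Lemma dotZl a x y : dot (a *: x) y = a * dot x y.
Proof. by rewrite dotC dotZr dotC. Qed.

Lemma dotNr x y : dot x (- y) = - dot x y.
Proof. by rewrite -scaleN1r dotZr mulN1r. Qed.

Lemma dot0r x : dot x 0 = 0.
Proof. by rewrite -(scale0r 0) dotZr mul0r. Qed.

Lemma dot_sumr I (r : seq I) (P : pred I) (F : I -> 'rV[R]_n) x :
  dot x (\sum_(i <- r | P i) F i) = \sum_(i <- r | P i) dot x (F i).
Proof.
exact: (big_morph (dot x) (fun y z => dotDr x y z) (dot0r x)).
Qed.

Lemma dot_delta x i : dot x (delta_mx 0 i) = x 0 i.
Proof.
rewrite /dot (bigD1 i)//= big1 ?addr0 => [|j /negPf ji]; rewrite mxE ?ji ?mulr0//.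
by rewrite !eqxx mulr1.
Qed.

Lemma dot_ge0 x : 0 <= dot x x.
Proof. by apply: sumr_ge0 => i _; rewrite -expr2 sqr_ge0. Qed.

Lemma dot_eq0 x : (dot x x == 0) = (x == 0).
Proof.
apply/idP/eqP => [|->]; last by rewrite dot0r.
rewrite /dot psumr_eq0 => [/allP x0|i _]; last by rewrite -expr2 sqr_ge0.
apply/rowP => i; rewrite mxE; apply/eqP.
by have := x0 i; rewrite mem_index_enum -expr2 sqrf_eq0; exact.
Qed.

End dot.

Section random_walk.
Context {R : realType} {n : nat}.
Hypothesis n_gt0 : (0 < n)%N.
Implicit Types (x y : 'rV[R]_n) (f g : R -> R) (w e h : R).

(** One step of the simple random walk: the mean of [f (w + dot x v)] over the [2 * n] vectors [v]
    that are plus or minus a basis vector. *)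
Definition avg x f w : R :=
  (2 * n%:R)^-1 * \sum_(i < n) (f (w + x 0 i) + f (w - x 0 i)).

Let c_gt0 : (0 : R) < (2 * n%:R)^-1.
Proof. by rewrite invr_gt0 mulr_gt0// ltr0n. Qed.

Let nR : (n%:R : R) != 0. Proof. by rewrite pnatr_eq0 -lt0n. Qed.

Lemma le_avg x f g w : (forall s, f s <= g s) -> avg x f w <= avg x g w.
Proof.
by move=> fg; rewrite ler_pM2l//; apply: ler_sum => i _; exact: lerD.
Qed.

Lemma avg_lin x f g a b w :
  avg x (fun s => a * f s + b * g s) w = a * avg x f w + b * avg x g w.
Proof.
rewrite /avg !mulr_sumr -big_split/=; apply: eq_bigr => i _; ring.
Qed.

Lemma avg_cst x a w : avg x (fun=> a) w = a.
Proof.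
by rewrite /avg sumr_const card_ord -mulr_natl; field.
Qed.

Lemma avg_shift x f a w : avg x (fun s => f (s + a)) w = avg x f (w + a).
Proof.
by rewrite /avg; congr (_ * _); apply: eq_bigr => i _; rewrite !(addrAC w a).
Qed.

Lemma avg_dist x f g e w : (forall s, `|f s - g s| <= e) ->
  `|avg x f w - avg x g w| <= e.
Proof.
move=> fg.
have := @avg_lin x f g 1 (-1) w; rewrite mul1r mulN1r => <-.
rewrite ler_norml; apply/andP; split.
  rewrite -(avg_cst x (- e) w); apply: le_avg => s.
  by have := fg s; rewrite mul1r mulN1r ler_norml => /andP[].
rewrite -(avg_cst x e w); apply: le_avg => s.
by have := fg s; rewrite mul1r mulN1r ler_norml => /andP[].
Qed.

Lemma avgC x y f w : avg x (avg y f) w = avg y (avg x f) w.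
Proof.
rewrite /avg; congr (_ * _).
under eq_bigr do rewrite -mulrDr -big_split.
under [RHS]eq_bigr do rewrite -mulrDr -big_split.
rewrite -!mulr_sumr; congr (_ * _); rewrite exchange_big/=.
apply: eq_bigr => i _; apply: eq_bigr => j _.
rewrite !addrA (addrAC w (x 0 j)) (addrAC w (- x 0 j)) (addrAC w (x 0 j)).
rewrite (addrAC w (- x 0 j) (- y 0 i)).
by rewrite -!addrA; congr (_ + _); rewrite addrCA.
Qed.

Lemma iter_avg_dist x f g e m w : (forall s, `|f s - g s| <= e) ->
  `|iter m (avg x) f w - iter m (avg x) g w| <= e.
Proof.
by move=> fg; elim: m w => [|m IH] w //=; exact: avg_dist.
Qed.

(* Lindeberg's exchange argument: the steps of the walk are replaced one by one. *)
Lemma iter_avg_exchange x y f e m w :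
  (forall s, `|avg x f s - avg y f s| <= e) ->
  `|iter m (avg x) f w - iter m (avg y) f w| <= m%:R * e.
Proof.
elim: m f => [|m IH] f fe; first by rewrite mul0r subrr normr0.
rewrite !iterSr -(subrKA (iter m (avg x) (avg y f) w)).
rewrite (le_trans (ler_normD _ _))// -addn1 natrD mulrDl mul1r addrC lerD//.
  apply: IH => s; rewrite avgC; exact: avg_dist.
exact: iter_avg_dist.
Qed.

(** [pos (dot u v)] is the support function at [u] of the segment from 0 to [v]; this is why the
    walk is tested on the positive part. *)
Definition pos w : R := Num.max 0 w.

Lemma posP w : (0 <= w /\ pos w = w) \/ (w <= 0 /\ pos w = 0).
Proof. by rewrite /pos; case: (leP 0 w); [left|right; split=> //; exact: ltW]. Qed.

(** The second derivative [6 * pos] of [pos ^ 3] is 6-Lipschitz, so the second-order Taylor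
    remainder is at most [6 * |y| ^ 3 / 6]. *)
Lemma pos_cube_taylor w (y : R) :
  `|pos (w + y) ^+ 3 - pos w ^+ 3 - 3 * pos w ^+ 2 * y - 3 * pos w * y ^+ 2|
  <= `|y| ^+ 3.
Proof.
have [[w0 ->]|[w0 ->]] := posP w; have [[y0 ->]|[y0 ->]] := posP (w + y).
- by rewrite (_ : _ - _ = y ^+ 3) ?normrX//; ring.
- rewrite (ler0_norm (_ : y <= 0)); last lra.
  have -> : (0 : R) ^+ 3 - w ^+ 3 - 3 * w ^+ 2 * y - 3 * w * y ^+ 2 =
     (- (w + y)) ^+ 3 - (- y) ^+ 3 by ring.
  have : (0 : R) <= (- (w + y)) ^+ 3 by apply: exprn_ge0; lra.
  have : (- (w + y)) ^+ 3 <= (- y) ^+ 3 by apply: lerXn2r; rewrite ?nnegrE; lra.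
  move: (_ ^+ 3) (_ ^+ 3) => u v uv v0; rewrite ler_norml; lra.
- rewrite (ger0_norm (_ : 0 <= y)); last lra.
  rewrite !expr0n/= !mulr0 !mul0r !subr0 ger0_norm; last exact: exprn_ge0.
  by apply: lerXn2r; rewrite ?nnegrE; lra.
- by rewrite !expr0n/= !mulr0 !mul0r !subr0 normr0 exprn_ge0.
Qed.

(** First-order terms cancel by symmetry, and second-order ones add up to [3 * pos w / n] because
    [x] is a unit vector: the main term does not depend on the direction. *)
Lemma avg_pos_cube x w : dot x x = 1 ->
  `|avg x (fun s => pos s ^+ 3) w - (pos w ^+ 3 + 3 * pos w / n%:R)| <= 1.
Proof.
move=> x1.
have -> : pos w ^+ 3 + 3 * pos w / n%:R = (2 * n%:R)^-1 * \sum_(i < n)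
    (2 * pos w ^+ 3 + 6 * pos w * (x 0 i * x 0 i)).
  rewrite big_split/= sumr_const card_ord -mulr_sumr (x1 : \sum_(i < n) x 0 i * x 0 i = 1).
  by rewrite -mulr_natl; field.
rewrite /avg -mulrBr -sumrB normrM gtr0_norm// mulrC ler_pdivrMr ?mul1r; last first.
  by rewrite mulr_gt0// ltr0n.
apply: (@le_trans _ _ (\sum_(i < n) 2 * (x 0 i * x 0 i))); last first.
  rewrite -mulr_sumr (x1 : \sum_(i < n) x 0 i * x 0 i = 1) mulr1 ler_peMr//.
  by rewrite ler1n.
apply: le_trans (ler_norm_sum _ _ _) _; apply: ler_sum => i _.
have xi : `|x 0 i| <= 1.
  rewrite -(@ler_pXn2r _ 2)// ?nnegrE// expr1n real_normK ?num_real// -x1.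
  by rewrite /dot (bigD1 i)//= expr2 lerDl sumr_ge0// => j _; rewrite -expr2 sqr_ge0.
have := pos_cube_taylor w (x 0 i); have := pos_cube_taylor w (- x 0 i).
rewrite normrN.
have : `|x 0 i| ^+ 3 <= x 0 i * x 0 i.
  by rewrite exprS -[leRHS]expr2 -[leRHS]real_normK ?num_real// ler_piMl// sqr_ge0.
move: (`|x 0 i| ^+ 3) => z zx.
rewrite !ler_norml => /andP[h1 h2] /andP[h3 h4]; apply/andP; split; nra.
Qed.

(* Second difference of [pos ^ 3] with step [h]: a C^2 approximation of [pos]. *)
Definition smooth_pos h w : R :=
  (6 * h ^+ 2)^-1 * (pos (w + h) ^+ 3 - 2 * pos w ^+ 3 + pos (w - h) ^+ 3).

(** Since [pos ^ 3 / 6] has second derivative [pos], [smooth_pos h w] is a weighted mean of [pos]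
    over [w - h, w + h], and [pos] is 1-Lipschitz. *)
Lemma smooth_pos_dist h w : 0 < h -> `|pos w - smooth_pos h w| <= h.
Proof.
move=> h0; have hh : 0 < 6 * h ^+ 2 by rewrite mulr_gt0// exprn_gt0.
rewrite -(@ler_pM2l _ (6 * h ^+ 2))// -{1}(gtr0_norm hh) -normrM mulrBr.
rewrite mulVKf ?gt_eqF//.
have [[w0 ->]|[w0 ->]] := posP w; have [[wp ->]|[wp ->]] := posP (w + h);
  have [[wm ->]|[wm ->]] := posP (w - h); try lra.
- rewrite (_ : _ - _ = 0); last by ring.
  by rewrite normr0; nra.
- have : 0 <= (h - w) ^+ 3 by apply: exprn_ge0; lra.
  have : (h - w) ^+ 3 <= h ^+ 3 by apply: lerXn2r; rewrite ?nnegrE; lra.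
  rewrite ler_norml expr0n/= => h1 h2; apply/andP; split; nra.
- have : 0 <= (w + h) ^+ 3 by apply: exprn_ge0; lra.
  have : (w + h) ^+ 3 <= h ^+ 3 by apply: lerXn2r; rewrite ?nnegrE; lra.
  rewrite ler_norml expr0n/= => h1 h2; apply/andP; split; nra.
- rewrite expr0n/= !(mulr0,addr0,subr0) normr0; nra.
Qed.

Lemma avg_smooth_pos x y h w : 0 < h -> dot x x = 1 -> dot y y = 1 ->
  `|avg x (smooth_pos h) w - avg y (smooth_pos h) w| <= 2 / h ^+ 2.
Proof.
move=> h0 x1 y1.
pose cu s : R := pos s ^+ 3.
have E z : avg z (smooth_pos h) w = (6 * h ^+ 2)^-1 *
    (avg z cu (w + h) - 2 * avg z cu w + avg z cu (w - h)).
  rewrite -!(avg_shift z cu).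
  pose g1 s := 1 * cu (s + h) + (- 2) * cu s.
  have -> : smooth_pos h = fun s => (6 * h ^+ 2)^-1 * g1 s +
      (6 * h ^+ 2)^-1 * cu (s - h).
    by apply/funext => s; rewrite /smooth_pos /g1 /cu; ring.
  by rewrite (@avg_lin z g1) avg_lin; ring.
rewrite !E -mulrBr normrM gtr0_norm; last by rewrite invr_gt0 mulr_gt0// exprn_gt0.
have -> : 2 / h ^+ 2 = (6 * h ^+ 2)^-1 * 12.
  by field; rewrite gt_eqF.
rewrite ler_pM2l; last by rewrite invr_gt0 mulr_gt0// exprn_gt0.
(* The main term of [avg_pos_cube] is common to both directions and cancels. The weights 1, 2, 1
   then give 8, below the 12 required. *)
have K s : `|avg x cu s - avg y cu s| <= 2.
  have := avg_pos_cube s x1; have := avg_pos_cube s y1.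
  rewrite -/cu !ler_norml => /andP[h1 h2] /andP[h3 h4].
  apply/andP; split; lra.
have := K (w + h); have := K w; have := K (w - h).
rewrite !ler_norml => /andP[h1 h2] /andP[h3 h4] /andP[h5 h6].
by apply/andP; split; lra.
Qed.

(** Moments of the walk, by induction on [m]: the mean is kept, the variance grows by exactly
    [1 / n] per step, and the fourth moment is bounded above since the [x 0 i ^+ 4] sum to at most
    1. This upper bound enters with the factor [- c], whence the sign of [c]. *)
Lemma iter_avg_quartic x a b c m w : dot x x = 1 -> 0 <= c ->
  a * w + b * (w ^+ 2 + m%:R / n%:R) -
  c * (w ^+ 4 + 6 * m%:R / n%:R * w ^+ 2 + 3 * m%:R ^+ 2 / n%:R ^+ 2 +
       m%:R / n%:R) <=
  iter m (avg x) (fun s => a * s + b * s ^+ 2 - c * s ^+ 4) w.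
Proof.
move=> x1 c0; rewrite -exprVn; set q : R := n%:R^-1.
elim: m w => [|m IH] w /=.
  by rewrite !(mulr0, mul0r, addr0, expr0n).
apply: le_trans (le_avg x w IH).
set B : R := b * (m%:R * q) - c * (3 * m%:R ^+ 2 * q ^+ 2 + m%:R * q).
set b' : R := b - c * (6 * m%:R * q).
have -> : avg x (fun s => a * s + b * (s ^+ 2 + m%:R * q) -
    c * (s ^+ 4 + 6 * m%:R * q * s ^+ 2 + 3 * m%:R ^+ 2 * q ^+ 2 + m%:R * q)) w =
    (2 * n%:R)^-1 * \sum_(i < n) (2 * (a * w + b' * w ^+ 2 - c * w ^+ 4 + B) +
    (2 * b' - 12 * c * w ^+ 2) * (x 0 i * x 0 i) - 2 * c * (x 0 i ^+ 4)).
  by rewrite /avg; congr (_ * _); apply: eq_bigr => i _; rewrite /B /b'; ring.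
rewrite sumrB big_split/= sumr_const card_ord -!mulr_sumr (x1 : \sum_(i < n) x 0 i * x 0 i = 1).
have x4 : \sum_(i < n) x 0 i ^+ 4 <= 1.
  rewrite -x1; apply: ler_sum => i _.
  have xi : `|x 0 i| <= 1.
    rewrite -(@ler_pXn2r _ 2)// ?nnegrE// expr1n real_normK ?num_real// -x1.
    by rewrite /dot (bigD1 i)//= expr2 lerDl sumr_ge0// => j _; rewrite -expr2 sqr_ge0.
  rewrite -expr2 (exprM _ 2 2) [leLHS]expr2 ler_piMl ?sqr_ge0//.
  by rewrite -real_normK ?num_real// expr_le1.
have -> : (2 * n%:R)^-1 * ((2 * (a * w + b' * w ^+ 2 - c * w ^+ 4 + B)) *+ n +
    (2 * b' - 12 * c * w ^+ 2) * 1 - 2 * c * \sum_(i < n) x 0 i ^+ 4) =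
   a * w + b' * w ^+ 2 - c * w ^+ 4 + B + (b' - 6 * c * w ^+ 2) * q -
     c * (\sum_(i < n) x 0 i ^+ 4 * q).
  by rewrite -mulr_natl -mulr_suml /q; field.
rewrite -mulr_suml -[m.+1]addn1 natrD.
have q0 : 0 <= q by rewrite invr_ge0.
move: (\sum_(i < n) _) x4 => X X1.
have : c * (X * q) <= c * q by rewrite ler_wpM2l// ler_piMl.
rewrite /B /b'; move: (m%:R : R) (ler0n R m) => M M0.
have : 0 <= c * (q ^+ 2) by rewrite mulr_ge0// sqr_ge0.
nra.
Qed.

(* Bounds [pos] from below by [s / 2 + (3 s^2 / A - s^4 / A^3) / 4], with
   [A = 2 k^3] comparable to the standard deviation of the walk. *)
Lemma iter_avg_pos_ge x k : (0 < k)%N -> dot x x = 1 ->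
  k%:R ^+ 3 / (4 * n%:R) <= iter (k ^ 6) (avg x) pos 0.
Proof.
move=> k0 x1; set K : R := k%:R.
have K0 : 1 <= K by rewrite /K ler1n.
have K3 : 0 < K ^+ 3 by apply: exprn_gt0; lra.
pose A := 2 * K ^+ 3.
have A0 : 0 < A by rewrite mulr_gt0.
pose f s : R := 2^-1 * s + (3 / (4 * A)) * s ^+ 2 - (4 * A ^+ 3)^-1 * s ^+ 4.
have fpos s : f s <= pos s.
  have : `|s| / 2 + s / 2 = pos s.
    have [[s0 ->]|[s0 ->]] := posP s; rewrite ?(ger0_norm s0) ?(ler0_norm s0); lra.
  have s2 : s ^+ 2 = `|s| ^+ 2 by rewrite real_normK ?num_real.
  have s4 : s ^+ 4 = `|s| ^+ 4 by rewrite (exprM _ 2 2) s2 -exprM.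
  move=> <-; rewrite /f s2 s4 [_^-1 * s]mulrC.
  have : 0 <= `|s| by [].
  move: `|s| => u u0; rewrite -addrA addrC lerD2r addrC -subr_ge0.
  (* The even part of [f] touches [u / 2] at [u = A], which explains the double root. *)
  have -> : u / 2 - (- ((4 * A ^+ 3)^-1 * u ^+ 4) + 3 / (4 * A) * u ^+ 2) =
    u * (u - A) ^+ 2 * (u + 2 * A) / (4 * A ^+ 3).
    by field; rewrite gt_eqF.
  apply: mulr_ge0; last by rewrite invr_ge0 mulr_ge0// exprn_ge0// ltW.
  by apply: mulr_ge0; [rewrite mulr_ge0// sqr_ge0 | lra].
have step : iter (k ^ 6) (avg x) f 0 <= iter (k ^ 6) (avg x) pos 0.
  move: (0 : R); elim: (k ^ 6)%N => [|m IH] w //=; exact: le_avg.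
apply: le_trans step.
have c0 : 0 <= (4 * A ^+ 3)^-1 by rewrite invr_ge0 mulr_ge0// exprn_ge0// ltW.
apply: le_trans (iter_avg_quartic _ _ _ _ x1 c0).
rewrite mulr0 add0r !expr0n/= !(mulr0, add0r) natrX -/K -exprVn.
set q : R := n%:R^-1.
have -> : K ^+ 3 / (4 * n%:R) = K ^+ 3 * q / 4 by rewrite /q; field.
have -> : 3 / (4 * A) * (K ^+ 6 * q) = 3 * K ^+ 3 * q / 8.
  by rewrite /A; field; rewrite gt_eqF//; lra.
have -> : (4 * A ^+ 3)^-1 * (3 * (K ^+ 6) ^+ 2 * q ^+ 2 + K ^+ 6 * q) =
   3 * K ^+ 3 * q ^+ 2 / 32 + K ^- 3 * q / 32.
  by rewrite /A; field; rewrite gt_eqF//; lra.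
have q0 : 0 <= q by rewrite invr_ge0.
have q1 : q <= 1 by rewrite invf_le1 ?ltr0n// ler1n.
have Ki : K ^- 3 <= K ^+ 3.
  apply: (@le_trans _ _ 1); last by rewrite exprn_ege1.
  by rewrite invf_le1// exprn_ege1.
have : K ^- 3 * q <= K ^+ 3 * q by rewrite ler_wpM2r.
have : K ^+ 3 * q ^+ 2 <= K ^+ 3 * q.
  by rewrite ler_pM2l// expr2 ler_piMl.
lra.
Qed.

Definition steps : seq 'rV[R]_n :=
  [seq delta_mx 0 i | i <- enum 'I_n] ++ [seq - delta_mx 0 i | i <- enum 'I_n].

Fixpoint walk_pts m : seq 'rV[R]_n :=
  if m is m'.+1 then [seq p + v | p <- walk_pts m', v <- steps] else [:: 0].

(** For [f = pos] and [w = 0] the right-hand side is, as a function of [x], a positive multiple of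
    the support function of a zonotope. *)
Lemma iter_avgE x f m w : iter m (avg x) f w =
  (2 * n%:R) ^- m * \sum_(s <- walk_pts m) f (w + dot x s).
Proof.
elim: m f => [|m IH] f.
  by rewrite /= big_seq1 dot0r addr0 invr1 mul1r.
rewrite iterSr IH big_allpairs_dep/= exprSr invfM -mulrA; congr (_ * _).
rewrite /avg -mulr_sumr; congr (_ * _); apply: eq_bigr => s _.
rewrite big_cat/= !big_map -enumT !big_enum big_split/=.
by congr (_ + _); apply: eq_bigr => i _; rewrite dotDr ?dotNr dot_delta addrA.
Qed.

(** Smoothing at scale [h = k ^ 2] costs [2 * h], and exchanging [k ^ 6] steps costs
    [k ^ 6 * 2 / h ^ 2]. Both equal [2 * k ^ 2], which is of lower order than the mean itself, at
    least of order [k ^ 3]. *)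
Lemma iter_avg_pos_dist x y k : (0 < k)%N -> dot x x = 1 -> dot y y = 1 ->
  `|iter (k ^ 6) (avg x) pos 0 - iter (k ^ 6) (avg y) pos 0| <= 4 * k%:R ^+ 2.
Proof.
move=> k0 x1 y1; set K : R := k%:R.
have K0 : 1 <= K by rewrite /K ler1n.
have h0 : 0 < K ^+ 2 by apply: exprn_gt0; lra.
have hx := iter_avg_dist x (k ^ 6) 0 (fun s => smooth_pos_dist s h0).
have hy := iter_avg_dist y (k ^ 6) 0 (fun s => smooth_pos_dist s h0).
have := @iter_avg_exchange x y _ _ (k ^ 6) 0 (fun s => avg_smooth_pos s h0 x1 y1).
rewrite natrX -/K.
have -> : K ^+ 6 * (2 / K ^+ 2 ^+ 2) = 2 * K ^+ 2 by field; rewrite gt_eqF//; lra.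
move: hx hy; rewrite !ler_norml => /andP[h1 h2] /andP[h3 h4] /andP[h5 h6].
apply/andP; split; lra.
Qed.

Lemma norm_zonotope_approx e : 0 < e -> exists vs : seq 'rV[R]_n,
  forall x, dot x x = 1 ->
    \sum_(v <- vs) pos (dot x v) <= 1 <= (1 + e) * \sum_(v <- vs) pos (dot x v).
Proof.
move=> e0.
pose k := (Num.truncn ((2 + e) * 16 * n%:R / e)).+1.
set K : R := k%:R.
have kK : (2 + e) * 16 * n%:R / e <= K.
  by apply: ltW; apply: truncnS_gt.
have K1 : 1 <= K by rewrite /K ler1n.
pose x0 : 'rV[R]_n := delta_mx 0 (Ordinal n_gt0).
have x01 : dot x0 x0 = 1 by rewrite dot_delta mxE !eqxx.
pose H x := iter (k ^ 6) (avg x) pos 0.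
pose D := H x0 + 4 * K ^+ 2.
have H0 : K ^+ 3 / (4 * n%:R) <= H x0 by exact: iter_avg_pos_ge.
have K2 : 0 < K ^+ 2 by apply: exprn_gt0; lra.
have n0 : (0 : R) < n%:R by rewrite ltr0n.
(* Equivalent to [D <= (1 + e) * (H x0 - 4 * K ^+ 2)], where [D] bounds [H] from above and
   [H x0 - 4 * K ^+ 2] bounds it from below on the unit sphere. The choice of [k] is made for
   this. *)
have DD : (2 + e) * (4 * K ^+ 2) <= e * H x0.
  apply: (@le_trans _ _ (e * (K ^+ 3 / (4 * n%:R)))); last by rewrite ler_pM2l.
  rewrite [leRHS]mulrA ler_pdivlMr; last by rewrite mulr_gt0.
  move: kK; rewrite ler_pdivrMr// => kK.
  rewrite exprSr; nra.
have D0 : 0 < D.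
  apply: ltr_wpDl; last by nra.
  by apply: le_trans H0; rewrite divr_ge0// ?exprn_ge0//; lra.
exists [seq (D^-1 * (2 * n%:R) ^- (k ^ 6)) *: s | s <- walk_pts (k ^ 6)] => x x1.
have -> : \sum_(v <- [seq (D^-1 * (2 * n%:R) ^- (k ^ 6)) *: s | s <- walk_pts (k ^ 6)])
    pos (dot x v) = D^-1 * H x.
  rewrite big_map /H iter_avgE mulrA mulr_sumr; apply: eq_bigr => s _.
  rewrite dotZr add0r /pos maxr_pMr ?mulr0//.
  by rewrite mulr_ge0// invr_ge0 ?ltW// exprn_gt0// mulr_gt0.
have k0 : (0 < k)%N by [].
have := iter_avg_pos_dist k0 x1 x01; rewrite -/(H x) -/(H x0) -/K.
rewrite ler_norml => /andP[h1 h2].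
have -> : (1 + e) * (D^-1 * H x) = (1 + e) * H x / D by ring.
rewrite (mulrC _ (H x)) ler_pdivrMr// ler_pdivlMr// !mul1r /D.
by apply/andP; split; nra.
Qed.

End random_walk.

(** * Volume *)

Section affine_change_of_variables.
Context {R : realType}.
Local Notation T := (measurableTypeR R).

Definition aff1 (c b : R) (x : T) : T := c * x + b.

Lemma measurable_aff1 c b : measurable_fun setT (aff1 c b).
Proof. by apply: measurable_funD => //; exact: measurable_funM. Qed.

Lemma lebesgue_measure_aff1 c b (A : set T) : 0 < c -> measurable A ->
  (c%:E * lebesgue_measure (aff1 c b @^-1` A) = lebesgue_measure A)%E.
Proof.
move=> c0 mA; apply/esym.
apply: (@lebesgue_measure_unique R (mscale (NngNum (ltW c0))
  (pushforward lebesgue_measure (aff1 c b)))) => //.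
  exact: measurable_aff1.
move=> ? _ [[u v]] _ <-; rewrite /= /mscale/= /pushforward.
have -> : aff1 c b @^-1` `]u, v] = `](u - b) / c, (v - b) / c]%classic.
  apply/seteqP; split=> x; rewrite /= !in_itv/= /aff1 ltr_pdivrMr// ler_pdivlMr//.
    by rewrite mulrC => /andP[? ?]; apply/andP; split; lra.
  by rewrite mulrC => /andP[? ?]; apply/andP; split; lra.
rewrite !lebesgue_measure_itv/= !lte_fin ltr_pM2r ?invr_gt0// ltrD2r.
case: ifPn => _; last by rewrite mule0.
by rewrite -!EFinB -EFinM; congr EFin; field; rewrite gt_eqF.
Qed.

Definition afft n c (b : 'I_n -> R) (t : n.-tuple T) : n.-tuple T :=
  [tuple aff1 c (b i) (tnth t i) | i < n].

Lemma measurable_afft n c (b : 'I_n -> R) : measurable_fun setT (afft c b).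
Proof.
apply/measurable_fun_tnthP => i.
rewrite (_ : _ \o _ = aff1 c (b i) \o (@tnth n T ^~ i)); last first.
  by apply/funext => t; rewrite /= tnth_mktuple.
exact: measurableT_comp (measurable_aff1 _ _) (measurable_tnth i).
Qed.

(** Uniqueness of the product measure reduces the induction step to rectangles, with the
    one-dimensional case on the first factor and the induction hypothesis on the second. *)
Lemma lebesgue_tuple_afft n c (b : 'I_n -> R) (A : set (n.-tuple T)) :
  0 < c -> measurable A ->
  ((c ^+ n)%:E * lebesgue_tuple n (afft c b @^-1` A) = lebesgue_tuple n A)%E.
Proof.
move=> c0; elim: n b A => [|n IH] b A mA.
  rewrite expr0 mul1e; congr (lebesgue_tuple 0 _).
  by apply/seteqP; split=> t /=; rewrite [afft _ _ _]tuple0 [t]tuple0.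
pose b' i := b (lift ord0 i).
pose G (p : T * n.-tuple T) := (aff1 c (b ord0) p.1, afft c b' p.2).
have mG : measurable_fun setT G.
  apply: measurable_fun_pair.
    exact: measurableT_comp (measurable_aff1 _ _) measurable_fst.
  exact: measurableT_comp (measurable_afft _ _) measurable_snd.
rewrite /= /cons_measure /pushforward.
have -> : @cons_pair R n @^-1` (afft c b @^-1` A) = G @^-1` (@cons_pair R n @^-1` A).
  apply/funext => -[x t]; rewrite /preimage/=; congr A.
  apply: eq_from_tnth => i; rewrite tnth_mktuple.
  by case: (unliftP ord0 i) => [k ->|->//]; rewrite !tnthS tnth_mktuple.
have mcA : measurable (@cons_pair R n @^-1` A).
  by rewrite -[X in measurable X]setTI; exact: measurable_cons_pair.
move: (_ @^-1` A) mcA => {}A {}mA.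
apply/esym.
apply: (@product_measure_unique _ _ _ _ _ lebesgue_measure (lebesgue_tuple n)
  (mscale (NngNum (ltW (exprn_gt0 n.+1 c0)))
  (pushforward (lebesgue_measure \x lebesgue_tuple n)%E G))) => //.
move=> X Y mX mY; rewrite /= /mscale/= /pushforward.
have -> : G @^-1` (X `*` Y) = (aff1 c (b ord0) @^-1` X) `*` (afft c b' @^-1` Y) by [].
rewrite product_measure1E//.
- by rewrite exprS EFinM muleACA lebesgue_measure_aff1// IH.
- by rewrite -[X in measurable X]setTI; exact: measurable_aff1.
- by rewrite -[X in measurable X]setTI; exact: measurable_afft.
Qed.

End affine_change_of_variables.

Section continuous_normedModType.
Context {R : realType} {V : normedModType R}.

Lemma continuous_affine (c : R) (b : V) : continuous (fun x : V => c *: x + b).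
Proof. by move=> x; apply: cvgD; [exact: scaler_continuous | exact: cvg_cst]. Qed.

Lemma continuous_addZ (v : V) : continuous (fun p : V * R => p.1 + p.2 *: v).
Proof.
move=> p; apply: cvgD; first exact: cvg_fst.
by apply: cvgZr_tmp; exact: cvg_snd.
Qed.

Lemma continuous_addZr (c : R) : continuous (fun p : V * V => p.1 + c *: p.2).
Proof.
move=> p; apply: cvgD; first exact: cvg_fst.
by apply: cvgZl_tmp; exact: cvg_snd.
Qed.

Lemma continuous_join (v : V) :
  continuous (fun p : V * R => p.2 *: v + (1 - p.2) *: p.1).
Proof.
move=> p; apply: cvgD; first by apply: cvgZr_tmp; exact: cvg_snd.
apply: cvgZ; last exact: cvg_fst.
by apply: cvgB; [exact: cvg_cst | exact: cvg_snd].
Qed.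

End continuous_normedModType.

Section volume.
Context {R : realType} {n : nat}.
Local Notation V := 'rV[R]_n.
Implicit Types (A B K L : set V) (x v b : V) (c d M : R).

Lemma volume_affine_preimage c b (A : set (rVBorel R n)) :
  0 < c -> measurable A ->
  ((c ^+ n)%:E * volume ((fun x : V => c *: x + b)%R @^-1` A) = volume A)%E.
Proof.
move=> c0 mA; rewrite /volume /lebesgue_rV /pushforward.
rewrite -(@lebesgue_tuple_afft _ n c (b 0) (row_of_tuple (n := n) @^-1` A))//.
  congr (_ * lebesgue_tuple n _)%E; apply/funext => t; rewrite /preimage/=.
  by congr A; apply/rowP => i; rewrite !mxE tnth_mktuple.
by rewrite -[X in measurable X]setTI; exact: measurable_row_of_tuple.
Qed.

Lemma closed_measurable_rV A : closed A -> measurable (A : set (rVBorel R n)).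
Proof.
move=> cA; rewrite -[A]setCK; apply: measurableC.
by apply: sub_sigma_algebra; rewrite openC.
Qed.

Lemma compact_measurable_rV A : compact A -> measurable (A : set (rVBorel R n)).
Proof.
move=> cA; apply: closed_measurable_rV; apply: compact_closed cA.
exact: (@norm_hausdorff R V).
Qed.

Lemma volume_affine c b A : 0 < c -> compact A ->
  volume [set c *: x + b | x in A] = ((c ^+ n)%:E * volume A)%E.
Proof.
move=> c0 cA.
rewrite -(@volume_affine_preimage c b [set c *: x + b | x in A])//.
  congr (_ * volume _)%E; apply/seteqP; split => x /=.
    move=> [y Ay] /addIr /(congr1 (fun z => c^-1 *: z)).
    by rewrite !scalerA mulVf ?gt_eqF// !scale1r => <-.
  by move=> Ax; exists x.
apply: compact_measurable_rV; apply: continuous_compact => //.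
apply: continuous_subspaceT; exact: (@continuous_affine R V).
Qed.

Definition cube M : set V := [set x | forall i, - M <= x 0 i <= M].

Lemma volume_cube M : 0 <= M -> volume (cube M) = ((2 * M) ^+ n)%:E.
Proof.
move=> M0.
have := @lebesgue_rV_box R n (fun=> `[- M, M]%classic) (fun=> measurable_itv _).
move=> E.
rewrite (_ : cube M = [set x : V | forall i, `[- M, M]%classic (x 0 i)]); last first.
  by apply/seteqP; split => x /= xM i; have := xM i; rewrite in_itv.
rewrite /volume E lebesgue_measure_itv/= lte_fin.
have -> : (if (- M < M)%R then M%:E - (- M)%:E else 0)%E = (2 * M)%:E.
  case: ifPn => [_|]; first by rewrite -EFinB; congr EFin; ring.
  by rewrite -leNgt => MM; congr EFin; lra.
by rewrite prodEFin prodr_const card_ord.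
Qed.

Lemma measurable_cube M : measurable (cube M : set (rVBorel R n)).
Proof.
apply: closed_measurable_rV.
rewrite (_ : cube M = \bigcap_i [set x : V | - M <= x 0 i <= M]); last first.
  by apply/seteqP; split => [x xM i _|x xM i]; [exact: xM | exact: (xM i)].
apply: closed_bigI => i _.
have -> : [set x : V | - M <= x 0 i <= M] = (fun x : V => x 0 i) @^-1` `[- M, M].
  by apply/seteqP; split => x /=; rewrite in_itv.
apply: preimage_closed; last exact: itv_closed.
by move=> x _; exact: coord_continuous.
Qed.

Lemma compact_cube A : compact A -> exists2 M, 0 < M & A `<=` cube M.
Proof.
move=> /compact_bounded[M [_ MA]]; exists (`|M| + 1) => [|x Ax i].
  by rewrite ltr_pwDr.
have /MA : M < `|M| + 1 by rewrite (le_lt_trans (ler_norm _))// ltrDl.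
move=> /(_ x Ax); rewrite -ler_norml; apply: le_trans.
by rewrite [leRHS]/Num.norm/= mx_normrE; apply: (@le_bigmax _ _ _ 0 (fun ij => `|x ij.1 ij.2|) (0, i)).
Qed.

Lemma le_volume A B : measurable (A : set (rVBorel R n)) ->
  measurable (B : set (rVBorel R n)) -> A `<=` B -> (volume A <= volume B)%E.
Proof. by move=> mA mB AB; apply: le_measure; rewrite ?inE. Qed.

Lemma volume_fin A : compact A -> volume A \is a fin_num.
Proof.
move=> cA; have [M M0 AM] := compact_cube cA.
rewrite ge0_fin_numE ?measure_ge0//.
apply: le_lt_trans (le_volume (compact_measurable_rV cA) (measurable_cube M) AM) _.
by rewrite volume_cube ?ltW// ltry.
Qed.

End volume.

(** * Minkowski sums with segments *)

Section convexity.
Context {R : realType} {n : nat}.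
Local Notation V := 'rV[R]_n.
Implicit Types (A K L M : set V) (x y v w : V) (s t : R).

Lemma convex_setE A : convex_set A <->
  forall x y t, A x -> A y -> 0 <= t <= 1 -> A (t *: x + (1 - t) *: y).
Proof.
split=> [cA x y t Ax Ay /andP[t0 t1]|cA x y t].
  by have := cA x y (Itv01 t0 t1); rewrite !inE; apply.
by rewrite !inE => Ax Ay; apply: (cA x y t%:num) => //; rewrite ge0 le1.
Qed.

Definition ccx A := compact A /\ convex_set A.

Definition addseg L v : set V :=
  [set y | exists2 x, L x & exists2 t, 0 <= t <= 1 & y = x + t *: v].

Lemma subset_addseg L v : L `<=` addseg L v.
Proof.
by move=> x Lx; exists x => //; exists 0; rewrite ?lexx ?ler01// scale0r addr0.
Qed.

Lemma addsegS L M v : L `<=` M -> addseg L v `<=` addseg M v.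
Proof. by move=> LM _ [x /LM Mx [t t01 ->]]; exists x => //; exists t. Qed.

Lemma ccx_addseg L v : ccx L -> ccx (addseg L v).
Proof.
move=> [cL vL]; split.
  rewrite (_ : addseg L v = (fun p : V * R => p.1 + p.2 *: v) @` (L `*` `[0, 1])).
    apply: continuous_compact.
      by apply: continuous_subspaceT; exact: (@continuous_addZ R V).
    by apply: compact_setX => //; exact: segment_compact.
  apply/seteqP; split=> y.
    by move=> [x Lx [t t01 ->]]; exists (x, t) => //; split => //=; rewrite in_itv.
  move=> [[x t] /= [Lx]]; rewrite in_itv/= => t01 <-.
  by exists x => //; exists t.
apply/convex_setE => _ _ t [x Lx [a /andP[a0 a1] ->]] [y Ly [b /andP[b0 b1] ->]] /andP[t0 t1].
exists (t *: x + (1 - t) *: y); first by move/convex_setE : vL; apply; rewrite ?t0.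
exists (t * a + (1 - t) * b); first by apply/andP; split; nra.
by rewrite !scalerDr !scalerA addrACA -scalerDl.
Qed.

Lemma addsegC L v w : addseg (addseg L v) w = addseg (addseg L w) v.
Proof.
wlog suff : v w / addseg (addseg L v) w `<=` addseg (addseg L w) v.
  by move=> H; apply/seteqP; split; exact: H.
move=> _ [_ [x Lx [a a01 ->]] [b b01 ->]]; rewrite addrAC.
by exists (x + b *: w); [exists x => //; exists b | exists a].
Qed.

Lemma addsegZP L v t y : 0 <= t ->
  addseg L (t *: v) y <-> exists2 x, L x & exists2 r, 0 <= r <= t & y = x + r *: v.
Proof.
move=> t0; split=> [[x Lx [a /andP[a0 a1] ->]]|[x Lx [r /andP[r0 rt] ->]]].
  exists x => //; exists (a * t); last by rewrite scalerA.
  by rewrite mulr_ge0//= ler_piMl.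
exists x => //; have [t00|t_neq0] := eqVneq t 0.
  exists 0; rewrite ?lexx ?ler01//; congr (_ + _); rewrite scale0r.
  by rewrite (_ : r = 0) ?scale0r//; lra.
have {}t0 : 0 < t by rewrite lt_neqAle eq_sym t_neq0.
exists (r / t); last by rewrite scalerA divfK.
by rewrite divr_ge0// ?ler_pdivrMr ?mul1r// ltW.
Qed.

(* On each line parallel to [v] a convex set is an interval, which [addseg]
   lengthens at one end: the piece added from [t] to [t + s] is a translate of
   the one added from [0] to [s]. *)
Lemma addseg_diff L v s t : convex_set L -> 0 <= s -> 0 <= t ->
  addseg L ((t + s) *: v) `\` addseg L (t *: v) =
  (fun x => 1 *: x - t *: v) @^-1` (addseg L (s *: v) `\` L).
Proof.
move=> /convex_setE vL s0 t0; have ts0 : 0 <= t + s by exact: addr_ge0.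
apply/seteqP; split=> x /=; rewrite scale1r.
  move=> [/(addsegZP _ _ _ ts0)[l Ll [r /andP[r0 rts] ->]]] notin; split.
    apply/addsegZP => //; exists l => //; exists (r - t).
      rewrite subr_ge0 lerBlDl rts andbT leNgt; apply/negP => rt; apply: notin.
      by apply/addsegZP => //; exists l => //; exists r; rewrite // r0 ltW.
    by rewrite -addrA scalerBl.
  move=> Ll'; apply: notin; apply/addsegZP => //.
  eexists; first exact: Ll'.
  by exists t; rewrite ?t0 ?lexx// subrK.
move=> [/(addsegZP _ _ _ s0)[l Ll [r /andP[r0 rs] xE]]] notin; split.
  apply/addsegZP => //; exists l => //; exists (r + t); first by apply/andP; split; lra.
  by rewrite scalerDl addrA -xE subrK.
move=> /(addsegZP _ _ _ t0)[l' Ll' [r' /andP[r'0 r't] xE']]; apply: notin.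
have [d0|d_neq0] := eqVneq (t - r' + r) 0.
  by rewrite xE (_ : r = 0) ?scale0r ?addr0//; lra.
have d0 : 0 < t - r' + r by rewrite lt_neqAle eq_sym d_neq0; lra.
have lE : l = x - t *: v - r *: v by rewrite xE addrK.
have lE' : l' = x - r' *: v by rewrite xE' addrK.
(* The point [x - t *: v] lies on the segment from [l] to [l']: going along [v], [l] is [r] behind
   it and [l'] is [t - r'] ahead. *)
have -> : x - t *: v = ((t - r') / (t - r' + r)) *: l +
    (1 - (t - r') / (t - r' + r)) *: l'.
  rewrite lE lE'; apply/rowP => i; rewrite !mxE; field.
  by rewrite gt_eqF.
apply: vL => //; apply/andP; split; first by apply: divr_ge0; lra.
by rewrite ler_pdivrMr// mul1r; lra.
Qed.

(** Cauchy's equation: nonnegativity makes [g] monotone, and squeezing [m * t] between consecutive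
    integers bounds [m * |g t - t * g 1|] by [g 1] for every [m]. *)
Lemma additive_ge0_linear (g : R -> R) :
  (forall s t, 0 <= s -> 0 <= t -> g (s + t) = g s + g t) ->
  (forall t, 0 <= t -> 0 <= g t) -> forall t, 0 <= t -> g t = t * g 1.
Proof.
move=> gD g0.
have g00 : g 0 = 0 by have := gD 0 0 (lexx _) (lexx _); rewrite addr0; lra.
have gMn m t : 0 <= t -> g (m%:R * t) = m%:R * g t.
  move=> t0; elim: m => [|m IH]; first by rewrite !mul0r.
  by rewrite -addn1 natrD !mulrDl !mul1r gD ?IH// mulr_ge0.
have g_le s t : 0 <= s -> s <= t -> g s <= g t.
  move=> s0 st; rewrite -(subrKC s t) gD ?subr_ge0// lerDl.
  by apply: g0; rewrite subr_ge0.
move=> t t0.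
have bound m : `|m%:R * (g t - t * g 1)| <= g 1.
  have mt0 : 0 <= m%:R * t by rewrite mulr_ge0.
  have /andP[k1 k2] := truncn_itv mt0.
  set k := Num.truncn _ in k1 k2.
  have := g_le _ _ (ler0n _ k) k1; have := g_le _ _ mt0 (ltW k2).
  rewrite -(mulr1 k%:R) -(mulr1 k.+1%:R) !gMn// -[k.+1]addn1 natrD.
  move: k1 k2; rewrite -[k.+1]addn1 natrD => k1 k2 h1 h2.
  have g1 : 0 <= g 1 by exact: g0.
  have : k%:R * g 1 <= m%:R * t * g 1 by rewrite ler_wpM2r.
  have : m%:R * t * g 1 <= (k%:R + 1) * g 1 by rewrite ler_wpM2r// ltW.
  by rewrite ler_norml; lra.
apply/eqP; rewrite -subr_eq0; apply/negPn/negP => d0.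
have := bound (Num.truncn (g 1 / `|g t - t * g 1|)).+1.
rewrite normrM normr_nat leNgt => /negP; apply.
by rewrite -ltr_pdivrMr ?normr_gt0// truncnS_gt.
Qed.

Definition vol L : R := fine (volume L).

Lemma vol_ge0 L : 0 <= vol L.
Proof. by rewrite fine_ge0// measure_ge0. Qed.

Lemma volE L : compact L -> volume L = (vol L)%:E.
Proof. by move=> cL; rewrite fineK// volume_fin. Qed.

Lemma le_vol L M : compact L -> compact M -> L `<=` M -> vol L <= vol M.
Proof.
move=> cL cM LM; rewrite -lee_fin -!volE//.
by apply: le_volume => //; exact: compact_measurable_rV.
Qed.

Lemma vol_affine c b L : 0 < c -> compact L ->
  vol [set c *: x + b | x in L] = c ^+ n * vol L.
Proof. by move=> c0 cL; rewrite /vol volume_affine// volE. Qed.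

Lemma vol_addseg_add L v s t : ccx L -> 0 <= s -> 0 <= t ->
  vol (addseg L ((t + s) *: v)) + vol L =
  vol (addseg L (t *: v)) + vol (addseg L (s *: v)).
Proof.
move=> ccL s0 t0; have [cL vL] := ccL.
have cseg w : compact (addseg L w) by have [] := ccx_addseg w ccL.
have mseg w := compact_measurable_rV (cseg w).
have mL := compact_measurable_rV cL.
have split A B : compact A -> compact B -> B `<=` A ->
    (volume A = volume B + volume (A `\` B))%E.
  move=> cA cB BA; have mA := compact_measurable_rV cA.
  have mB := compact_measurable_rV cB.
  rewrite {1}(_ : A = B `|` (A `\` B)); last by rewrite setDUK.
  rewrite /volume measureU//; first exact: measurableD.
  by rewrite setDIK.
have sub : addseg L (t *: v) `<=` addseg L ((t + s) *: v).
  move=> x /(addsegZP _ _ _ t0)[l Ll [r /andP[r0 rt] ->]].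
  apply/addsegZP; first exact: addr_ge0.
  by exists l => //; exists r => //; apply/andP; split; lra.
have := split _ _ (cseg _) (cseg _) sub.
have := split _ _ (cseg (s *: v)) cL (@subset_addseg _ _).
have := volume_affine_preimage (- (t *: v)) ltr01 (measurableD (mseg (s *: v)) mL).
rewrite -addseg_diff// expr1n mul1e => ->.
rewrite (volE cL) !(volE (cseg _)) => h1 h2.
have fD : volume (addseg L (s *: v) `\` L) \is a fin_num.
  rewrite ge0_fin_numE ?measure_ge0//.
  have : (volume (addseg L (s *: v)) < +oo)%E by rewrite volE// ltry.
  apply: le_lt_trans; apply: le_volume => //; exact: measurableD.
move: h1 h2; rewrite -(fineK fD) -!EFinD => -[h1] [h2].
by rewrite h2 h1; ring.
Qed.

(** The volume gained by adding [t *: v] is additive in [t], by translation invariance, and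
    nonnegative, hence linear. *)
Lemma vol_addseg L v t : ccx L -> 0 <= t ->
  vol (addseg L (t *: v)) = vol L + t * (vol (addseg L v) - vol L).
Proof.
move=> ccL t0; have [cL vL] := ccL.
have cseg w : compact (addseg L w) by have [] := ccx_addseg w ccL.
pose g u := vol (addseg L (u *: v)) - vol L.
have := @additive_ge0_linear g; rewrite /g scale1r => <-//; first by ring.
  by move=> a b a0 b0; have := vol_addseg_add v ccL b0 a0; lra.
move=> a a0; rewrite subr_ge0; apply: le_vol => //; exact: subset_addseg.
Qed.

(** The properties of the volume that are inherited by the slope in any direction, so that segments
    can be treated one after the other. *)
Definition seg_affine (F : set V -> R) := [/\
  forall L, ccx L -> 0 <= F L,
  forall L M, ccx L -> ccx M -> L `<=` M -> F L <= F M &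
  forall L v t, ccx L -> 0 <= t ->
    F (addseg L (t *: v)) = F L + t * (F (addseg L v) - F L)].

Lemma seg_affine_vol : seg_affine vol.
Proof.
split=> [L _|L M [cL _] [cM _]|L v t]; first exact: vol_ge0.
  exact: le_vol.
exact: vol_addseg.
Qed.

Lemma le_affine (a b c d : R) :
  (forall t, 0 <= t -> a + t * b <= c + t * d) -> b <= d.
Proof.
move=> H; rewrite leNgt; apply/negP => db.
have bd : 0 < b - d by rewrite subr_gt0.
pose T := (`|c - a| + 1) / (b - d).
have T0 : 0 <= T by apply: divr_ge0; [exact: addr_ge0 | exact: ltW].
have := H _ T0; rewrite leNgt => /negP; apply; rewrite -subr_gt0.
have TE : T * (b - d) = `|c - a| + 1 by rewrite divfK// gt_eqF.
have -> : a + T * b - (c + T * d) = T * (b - d) - (c - a) by ring.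
by rewrite TE; have := ler_norm (c - a); lra.
Qed.

(* The slope is a limit of [F (L + t v) / t], hence inherits monotonicity. *)
Lemma seg_affine_slope F v : seg_affine F ->
  seg_affine (fun L => F (addseg L v) - F L).
Proof.
move=> [F0 FS Fa]; split=> [L ccL|L M ccL ccM LM|L w t ccL t0].
- by rewrite subr_ge0 FS//; [exact: ccx_addseg | exact: subset_addseg].
- apply: (@le_affine (F L) _ (F M)) => t t0; rewrite -!Fa//.
  by apply: FS; [exact: ccx_addseg.. | exact: addsegS].
by rewrite addsegC !Fa//; [rewrite (addsegC L w v); ring | exact: ccx_addseg].
Qed.

Definition addsegs L (vs : seq V) := foldr (fun v X => addseg X v) L vs.

Lemma ccx_addsegs L vs : ccx L -> ccx (addsegs L vs).
Proof. by move=> cL; elim: vs => //= v vs; exact: ccx_addseg. Qed.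

(** Removing the segment along [v] writes [F] as itself plus [t] times its slope, both on the sum of
    the other segments. The induction hypothesis, applied to [F] and to the slope, gives
    [p + q * 'X]. *)
Lemma seg_affine_poly F vs : seg_affine F ->
  exists p : set V -> {poly R}, [/\
    forall k L, ccx L -> 0 <= (p L)`_k,
    forall k L M, ccx L -> ccx M -> L `<=` M -> (p L)`_k <= (p M)`_k &
    forall L t, ccx L -> 0 <= t ->
      F (addsegs L [seq t *: v | v <- vs]) = (p L).[t]].
Proof.
elim: vs F => [|v vs IH] F aF.
  have [F0 FS _] := aF; exists (fun L => (F L)%:P); split => [k L ccL|k L M ccL ccM LM|L t _ _].
  - by rewrite coefC; case: ifP => // _; exact: F0.
  - by rewrite !coefC; case: ifP => // _; exact: FS.
  - by rewrite hornerC.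
have [p [p0 pS pE]] := IH F aF.
have [q [q0 qS qE]] := IH _ (seg_affine_slope v aF).
exists (fun L => p L + q L * 'X); split => [k L ccL|k L M ccL ccM LM|L t ccL t0].
- rewrite coefD coefMX addr_ge0 ?p0//; case: ifP => // _; exact: q0.
- by rewrite !coefD !coefMX lerD ?pS//; case: ifP => // _; exact: qS.
rewrite /= hornerD hornerMX -pE// -qE//.
by have [_ _ Fa] := aF; rewrite Fa ?(mulrC t)//; exact: ccx_addsegs.
Qed.

End convexity.

(** * Separation and zonotopes *)

Section zonotopes.
Context {R : realType} {n : nat}.
Local Notation V := 'rV[R]_n.
Implicit Types (A K L M : set V) (x y z u v : V) (s t e : R).

Lemma continuous_sum_coord (g : 'I_n -> R -> R) :
  (forall i, continuous (g i)) -> continuous (fun x : V => \sum_i g i (x 0 i)).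
Proof.
move=> cg; apply: continuous_big => [|i _]; first exact: add_continuous.
move=> x; apply: (@continuous_comp V R R (fun x => x 0 i) (g i)).
  exact: coord_continuous.
exact: cg.
Qed.

Lemma continuous_sqdist y : continuous (fun x : V => dot (y - x) (y - x)).
Proof.
pose g (i : 'I_n) (r : R) := (y 0 i - r) * (y 0 i - r).
have cg i : continuous (g i).
  by move=> r; apply: cvgM; apply: cvgB; (exact: cvg_cst || exact: cvg_id).
rewrite (_ : (fun x => _) = fun x : V => \sum_i g i (x 0 i)).
  exact: continuous_sum_coord.
by apply/funext => x; apply: eq_bigr => i _; rewrite !mxE.
Qed.

(** Plays the role of Cauchy-Schwarz: it gives [dot x y <= 1] for [x] and [y] in the unit ball. *)
Lemma dot_AMGM x y : 2 * dot x y <= dot x x + dot y y.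
Proof.
rewrite mulr_sumr -big_split/=; apply: ler_sum => i _.
by have := sqr_ge0 (x 0 i - y 0 i); nra.
Qed.

(** The vector from the point [p] of [A] nearest to [y] to [y] itself separates. *)
Lemma separation A y : ccx A -> ~ A y ->
  exists u, forall z, A z -> dot u z < dot u y.
Proof.
move=> [cA /convex_setE vA] Ay.
have [A0|nA] := pselect (A !=set0); last first.
  by exists 0 => z Az; case: nA; exists z.
have [|p Ap pmin] := @EVT_min_rV R n (fun x => dot (y - x) (y - x)) A A0 cA.
  by apply: continuous_subspaceT; exact: continuous_sqdist.
rewrite inE in Ap.
exists (y - p) => z Az; set u := y - p.
have u0 : 0 < dot u u.
  rewrite lt_neqAle dot_ge0 andbT eq_sym dot_eq0 subr_eq0.
  by apply/eqP => yp; apply: Ay; rewrite yp.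
have key t : 0 < t <= 1 -> 2 * dot u (z - p) <= t * dot (z - p) (z - p).
  move=> /andP[t0 t1]; have Az' : A (t *: z + (1 - t) *: p).
    by apply: vA => //; rewrite ltW.
  have := pmin (t *: z + (1 - t) *: p); rewrite inE => /(_ Az').
  have -> : y - (t *: z + (1 - t) *: p) = u + (- t) *: (z - p).
    by apply/rowP => i; rewrite !mxE; ring.
  rewrite -/u; move: (u) (z - p) => u' w.
  rewrite dotDl !dotDr !dotZl !dotZr (dotC w) => h.
  by rewrite -(ler_pM2l t0); lra.
have up0 : dot u (z - p) <= 0.
  rewrite leNgt; apply/negP => d0.
  set d := dot u (z - p) in d0 key.
  have q0 := dot_ge0 (z - p); set q := dot (z - p) (z - p) in q0 key.
  (* A step in (0, 1], also when [q = 0], that is small enough for [t * q < 2 * d]. *)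
  have := key (d / (d + q)) _; rewrite divr_gt0 ?ltr_pwDl// ler_pdivrMr ?ltr_pwDl//.
  rewrite mul1r lerDl q0 => /(_ isT).
  rewrite mulrAC ler_pdivlMr ?ltr_pwDl//; nra.
have : dot u y = dot u p + dot u u by rewrite -dotDr subrKC.
have : dot u z = dot u p + dot u (z - p) by rewrite -dotDr subrKC.
lra.
Qed.

Definition zonotope (vs : seq V) : set V := addsegs [set 0] vs.

Lemma addsegsE L (vs : seq V) :
  addsegs L vs = [set x + z | x in L & z in zonotope vs].
Proof.
elim: vs => [|v vs IH] /=.
  apply/seteqP; split=> [x Lx|_ [x Lx [z -> <-]]]; last by rewrite addr0.
  by exists x => //; exists 0; rewrite ?addr0.
rewrite IH; apply/seteqP; split=> [_ [_ [x Lx [z Zz <-]] [t t01 ->]]|].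
  exists x => //; exists (z + t *: v); last by rewrite addrA.
  by exists z => //; exists t.
move=> _ [x Lx [_ [z Zz [t t01 ->]] <-]]; exists (x + z); last first.
  by exists t; rewrite ?addrA.
by exists x => //; exists z.
Qed.

Lemma zonotopeZ (vs : seq V) t :
  zonotope [seq t *: v | v <- vs] = [set t *: z | z in zonotope vs].
Proof.
elim: vs => [|v vs IH] /=.
  apply/seteqP; split=> [_ ->|_ [_ -> <-]]; last by rewrite scaler0.
  by exists 0; rewrite ?scaler0.
rewrite /zonotope /= -!/(zonotope _) IH; apply/seteqP; split.
  move=> _ [_ [z Zz <-] [a a01 ->]]; exists (z + a *: v).
    by exists z => //; exists a.
  by rewrite scalerDr !scalerA mulrC.
move=> _ [_ [z Zz [a a01 ->]] <-]; exists (t *: z); first by exists z.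
by exists a => //; rewrite scalerDr !scalerA mulrC.
Qed.

Lemma ccx_set1 x : ccx [set x].
Proof.
split; first exact: compact_set1.
by apply/convex_setE => _ _ t -> -> _; rewrite -scalerDl subrKC scale1r.
Qed.

Lemma zonotope_dot_le (vs : seq V) u z :
  zonotope vs z -> dot u z <= \sum_(v <- vs) pos (dot u v).
Proof.
elim: vs z => [|v vs IH] z; first by move=> ->; rewrite dot0r big_nil.
move=> [x /IH xle [t /andP[t0 t1] ->]]; rewrite big_cons dotDr dotZr addrC lerD//.
by have [[d0 ->]|[d0 ->]] := posP (dot u v); nra.
Qed.

(** Taking the better end of each segment attains the bound of [zonotope_dot_le], so the sum is the
    support function of the zonotope. *)
Lemma zonotope_dot_eq (vs : seq V) u :
  exists2 z, zonotope vs z & dot u z = \sum_(v <- vs) pos (dot u v).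
Proof.
elim: vs => [|v vs [z Zz zE]]; first by exists 0; rewrite // dot0r big_nil.
have [[d0 E]|[d0 E]] := posP (dot u v).
  exists (z + 1 *: v); first by exists z => //; exists 1; rewrite ?ler01 ?lexx.
  by rewrite big_cons E dotDr scale1r zE addrC.
exists (z + 0 *: v); first by exists z => //; exists 0; rewrite ?ler01 ?lexx.
by rewrite big_cons E scale0r addr0 zE add0r.
Qed.

Lemma euclidean_ballE x : euclidean_ball x <-> dot x x <= 1.
Proof.
rewrite /euclidean_ball/= /dot.
by under eq_bigr do rewrite expr2.
Qed.

Lemma dot_normalize x : x != 0 ->
  dot ((Num.sqrt (dot x x))^-1 *: x) ((Num.sqrt (dot x x))^-1 *: x) = 1.
Proof.
rewrite -dot_eq0 => x0; rewrite dotZl dotZr mulrA -invfM -expr2.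
by rewrite sqr_sqrtr ?dot_ge0// mulVf.
Qed.

(** Inclusions from inequalities of support functions: a point [z] of the zonotope is tested against
    its own direction, and a point of the ball outside the dilated zonotope against a separating
    direction. *)
Lemma zonotope_ball e : (0 < n)%N -> 0 < e -> exists2 vs : seq V,
  zonotope vs `<=` euclidean_ball &
  euclidean_ball `<=` [set (1 + e) *: z | z in zonotope vs].
Proof.
move=> n0 e0; have [vs vsP] := @norm_zonotope_approx R n n0 e e0.
have e1 : 0 < 1 + e by rewrite addr_gt0.
exists vs => [z Zz|y /euclidean_ballE yB].
  apply/euclidean_ballE; have [->|z0] := eqVneq z 0; first by rewrite dot0r.
  have /andP[+ _] := vsP _ (dot_normalize z0).
  move=> /(le_trans (zonotope_dot_le _ Zz)); rewrite dotZl.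
  rewrite mulrC -{1}(sqr_sqrtr (dot_ge0 z)) expr2 mulfK; last first.
    by rewrite gt_eqF// sqrtr_gt0 lt_neqAle dot_ge0 eq_sym dot_eq0 z0.
  by move=> z1; rewrite -(sqr_sqrtr (dot_ge0 z)) expr_le1// sqrtr_ge0.
have [[z Zz zE]|nZ] := pselect (exists2 z, zonotope vs z & z = (1 + e)^-1 *: y).
  by exists z => //; rewrite zE scalerA divff ?gt_eqF// scale1r.
have /separation : ~ zonotope vs ((1 + e)^-1 *: y).
  by move=> Zy; apply: nZ; eexists; first exact: Zy.
case=> [|u uP]; first exact/ccx_addsegs/ccx_set1.
exfalso.
have u0 : u != 0.
  apply/eqP => u0; have [z Zz _] := zonotope_dot_eq vs 0.
  by have := uP _ Zz; rewrite u0 !(dotC 0) !dot0r ltxx.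
pose c := (Num.sqrt (dot u u))^-1.
have c0 : 0 < c.
  by rewrite invr_gt0 sqrtr_gt0 lt_neqAle dot_ge0 eq_sym dot_eq0 u0.
have /andP[_] := vsP _ (dot_normalize u0); rewrite -/c.
have [z Zz <-] := zonotope_dot_eq vs (c *: u) => h2.
have h1 : (1 + e) * dot (c *: u) z < dot (c *: u) y.
  by rewrite !dotZl mulrCA ltr_pM2l// -ltr_pdivlMl// -dotZr uP.
have : 1 < dot (c *: u) y by exact: le_lt_trans h2 h1.
apply/negP; rewrite -leNgt; have := dot_AMGM (c *: u) y.
by rewrite dot_normalize//; lra.
Qed.

End zonotopes.

(** * Steiner's formula *)

Section interpolation.
Context {R : realType} (n : nat).
Implicit Types (f g : R -> R) (p : {poly R}).

Definition nodes_mx : 'M[R]_n.+1 := Vandermonde n.+1 (\row_(j < n.+1) j%:R).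

Lemma nodes_mx_unit : nodes_mx \in unitmx.
Proof.
rewrite unitmxE det_Vandermonde unitfE; apply/prodf_neq0 => i _.
apply/prodf_neq0 => j ij; rewrite !mxE subr_eq0 eqr_nat.
by rewrite gt_eqF.
Qed.

(* [interp f k] is the coefficient of ['X^k] in the polynomial of degree at most
   [n] that coincides with [f] at [0, ..., n]. *)
Definition interp f (k : 'I_n.+1) : R :=
  \sum_(j < n.+1) f j%:R * invmx nodes_mx j k.

Lemma eq_interp f g : (forall t, 0 <= t -> f t = g t) -> interp f =1 interp g.
Proof. by move=> fg k; apply: eq_bigr => j _; rewrite fg. Qed.

Lemma interp_horner p k : (size p <= n.+1)%N -> interp (horner p) k = p`_k.
Proof.
move=> sp.
have E : \row_(j < n.+1) p.[j%:R] = (\row_(i < n.+1) p`_i) *m nodes_mx.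
  apply/rowP => j; rewrite !mxE (horner_coef_wide _ sp).
  by apply: eq_bigr => i _; rewrite !mxE.
have := congr1 (fun v => (v *m invmx nodes_mx) 0 k) E.
rewrite mulmxK ?nodes_mx_unit// !mxE => <-.
by apply: eq_bigr => j _; rewrite !mxE.
Qed.

(** Only [n + 1] values enter [interp], so pointwise convergence of polynomials of bounded degree
    gives convergence of their coefficients. *)
Lemma interp_cvg (u : nat -> R -> R) f k :
  (forall t, 0 <= t -> u m t @[m --> \oo] --> f t) ->
  interp (u m) k @[m --> \oo] --> interp f k.
Proof.
move=> uf; apply: cvg_big => [|j _]; first exact: add_continuous.
by apply: cvgMr_tmp; exact: uf.
Qed.

Lemma coef_horner_le p k t : (forall i, 0 <= p`_i) -> 0 <= t ->
  p`_k * t ^+ k <= p.[t].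
Proof.
move=> p0 t0; have pt i : 0 <= p`_i * t ^+ i by rewrite mulr_ge0 ?exprn_ge0.
have [kp|pk] := ltnP k (size p); last first.
  by rewrite nth_default// mul0r horner_coef sumr_ge0.
rewrite horner_coef (bigD1 (Ordinal kp))//= lerDl.
by rewrite sumr_ge0.
Qed.

(** A positive coefficient of degree [k > n] would give [p]_k * t ^+ k <= C * t ^+
    n[, which fails once]p[_k * t > C]. *)
Lemma poly_growth p C : (forall i, 0 <= p`_i) ->
  (forall t, 1 <= t -> p.[t] <= C * t ^+ n) -> (size p <= n.+1)%N.
Proof.
move=> p0 pC; apply/leq_sizeP => k nk; apply/eqP/negPn/negP => pk0.
have pk : 0 < p`_k by rewrite lt_neqAle eq_sym pk0 p0.
pose t := `|C| / p`_k + 1.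
have t1 : 1 <= t by rewrite lerDr divr_ge0// ltW.
have t0 : 0 < t by exact: lt_le_trans t1.
have tn : 0 < t ^+ n by rewrite exprn_gt0.
have tk : t * t ^+ n <= t ^+ k by rewrite -exprS ler_weXn2l.
have := le_trans (coef_horner_le k p0 (ltW t0)) (pC _ t1).
have : p`_k * (t * t ^+ n) <= p`_k * t ^+ k by rewrite ler_pM2l.
move=> /le_trans /[apply]; rewrite mulrA ler_pM2r//.
rewrite mulrDr mulr1 mulrCA divff ?gt_eqF// mulr1.
by have := ler_norm C; lra.
Qed.

Lemma horner_scale_le p s t : (size p <= n.+1)%N -> (forall i, 0 <= p`_i) ->
  1 <= s -> 0 <= t -> p.[s * t] <= s ^+ n * p.[t].
Proof.
move=> sp p0 s1 t0; rewrite !(horner_coef_wide _ sp) mulr_sumr.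
apply: ler_sum => i _; rewrite exprMn mulrCA; apply: ler_wpM2r.
  by rewrite mulr_ge0 ?exprn_ge0.
by rewrite ler_weXn2l// -ltnS.
Qed.

End interpolation.

(** * The Steiner polynomial as a limit over zonotopes; properties of quermassintegrals *)

Section steiner.
Context {R : realType} {n : nat}.
Hypothesis n_gt0 : (0 < n)%N.
Local Notation V := 'rV[R]_n.
Implicit Types (K L M : set V) (b x : V) (c s t : R).

Lemma compact_euclidean_ball : compact (euclidean_ball : set V).
Proof.
apply: (@subclosed_compact _ _ (cube 1)).
- rewrite (_ : euclidean_ball =
      (fun x : V => dot (0 - x) (0 - x)) @^-1` [set r | r <= 1]).
    by apply: preimage_closed; [move=> x _; exact: continuous_sqdist | exact: closed_le].
  apply/seteqP; split => x; rewrite euclidean_ballE /=;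
    by rewrite sub0r dotNr dotC dotNr opprK.
- have := @rV_compact R n (fun=> `[(- 1 : R), 1]%classic) (fun=> @segment_compact R _ _).
  by congr compact; apply/seteqP; split => x /= + i => /(_ i); rewrite in_itv.
move=> x xB i; rewrite -ler_norml -(@ler_pXn2r _ 2)// ?nnegrE//.
rewrite expr1n real_normK ?num_real//; apply: le_trans xB.
by rewrite (bigD1 i)//= lerDl sumr_ge0// => j _; rewrite sqr_ge0.
Qed.

Lemma compact_parallel_body L t : compact L -> compact (parallel_body L t).
Proof.
move=> cL; rewrite (_ : parallel_body L t =
    (fun p : V * V => p.1 + t *: p.2) @` (L `*` euclidean_ball)).
  apply: continuous_compact.
    by apply: continuous_subspaceT; exact: (@continuous_addZr R V).
  by apply: compact_setX => //; exact: compact_euclidean_ball.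
apply/seteqP; split=> y.
  by move=> [x Lx [z Bz <-]]; exists (x, z).
by move=> [[x z] /= [Lx Bz] <-]; exists x => //; exists z.
Qed.

Definition pvol L t := vol (parallel_body L t).

Lemma pvol_growth L : compact L ->
  exists C, forall t, 1 <= t -> pvol L t <= C * t ^+ n.
Proof.
move=> cL; have [M M0 LM] := compact_cube cL.
exists ((2 * (M + 1)) ^+ n) => t t1; have t0 : 0 < t by exact: lt_le_trans t1.
rewrite -exprMn -lee_fin -volE; last exact: compact_parallel_body.
rewrite -mulrA -volume_cube; last by apply: mulr_ge0; lra.
apply: le_volume.
  by apply: compact_measurable_rV; exact: compact_parallel_body.
  exact: measurable_cube.
move=> _ [x /LM xM [b Bb <-]] i; rewrite !mxE.
have /andP[x1 x2] := xM i.
have /andP[b1 b2] : -1 <= b 0 i <= 1.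
  rewrite -ler_norml -(@ler_pXn2r _ 2)// ?nnegrE//.
  rewrite expr1n real_normK ?num_real//; apply: le_trans Bb.
  by rewrite (bigD1 i)//= lerDl sumr_ge0// => j _; rewrite sqr_ge0.
by apply/andP; split; nra.
Qed.

Lemma addsegs_parallel L (vs : seq V) t : zonotope vs `<=` euclidean_ball ->
  addsegs L [seq t *: v | v <- vs] `<=` parallel_body L t.
Proof.
move=> vB; rewrite addsegsE zonotopeZ => _ [x Lx [_ [z Zz <-] <-]].
by exists x => //; exists z => //; exact: vB.
Qed.

Lemma parallel_addsegs L (vs : seq V) s t :
  euclidean_ball `<=` [set s *: z | z in zonotope vs] ->
  parallel_body L t `<=` addsegs L [seq (s * t) *: v | v <- vs].
Proof.
move=> Bv; rewrite addsegsE zonotopeZ => _ [x Lx [b /Bv[z Zz <-] <-]].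
exists x => //; exists ((s * t) *: z); first by exists z.
by rewrite scalerA mulrC.
Qed.

(* [p m L] is the Steiner polynomial of [L] with respect to the [m]-th term of a
   sequence of zonotopes tending to the ball. *)
Lemma pvol_approx : exists p : nat -> set V -> {poly R}, [/\
  forall m k L, ccx L -> 0 <= (p m L)`_k,
  forall m k L M, ccx L -> ccx M -> L `<=` M -> (p m L)`_k <= (p m M)`_k,
  forall m L, ccx L -> (size (p m L) <= n.+1)%N &
  forall L t, ccx L -> 0 <= t -> (p m L).[t] @[m --> \oo] --> pvol L t].
Proof.
have /choice[vs vsP] m : exists vs : seq V, zonotope vs `<=` euclidean_ball /\
    euclidean_ball `<=` [set (1 + m.+1%:R^-1) *: z | z in zonotope vs].
  have [|v v1 v2] := @zonotope_ball R n m.+1%:R^-1 n_gt0.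
    by rewrite invr_gt0.
  by exists v.
have [p pP] := choice (fun m => seg_affine_poly (vs m) (@seg_affine_vol R n)).
have p_le m L t : ccx L -> 0 <= t -> (p m L).[t] <= pvol L t.
  move=> ccL t0; have [_ _ <-//] := pP m.
  apply: le_vol; first by have [] := ccx_addsegs [seq t *: v | v <- vs m] ccL.
    by apply: compact_parallel_body; have [] := ccL.
  by apply: addsegs_parallel; have [] := vsP m.
(* The degree could a priori be as large as the number of segments; the growth of [pvol] brings it
   down to [n]. *)
have p_size m L : ccx L -> (size (p m L) <= n.+1)%N.
  move=> ccL; have [cL _] := ccL; have [C CP] := pvol_growth cL.
  apply: (@poly_growth _ _ _ C) => [i|t t1]; first by have [+ _ _] := pP m; apply.
  by apply: le_trans (CP _ t1); apply: p_le => //; exact: le_trans t1.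
exists p; split=> // [m|m|L t ccL t0]; [by have [] := pP m | by have [] := pP m |].
pose e m : R := (1 + m.+1%:R^-1) ^+ n.
have e1 : e m @[m --> \oo] --> (1 : R).
  have h : 1 + m.+1%:R^-1 @[m --> \oo] --> (1 : R).
    by rewrite -[X in _ --> X]addr0; apply: cvgD; [exact: cvg_cst | exact: cvg_harmonic].
  by have := cvg_comp _ _ h (@exprn_continuous R n 1); rewrite expr1n.
(* The dilated zonotope contains the ball, so [pvol L t <= e m * (p m L).[t]]; in the surplus [(e m
   - 1) * (p m L).[t]] the polynomial is then bounded by [pvol L t]. *)
have le_p m : pvol L t - (e m - 1) * pvol L t <= (p m L).[t].
  have p0 : 0 <= (p m L).[t].
    have [h _ _] := pP m; rewrite horner_coef sumr_ge0// => i _.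
    by rewrite mulr_ge0 ?h ?exprn_ge0.
  have em : 1 <= 1 + m.+1%:R^-1 :> R by rewrite lerDl invr_ge0.
  have : pvol L t <= e m * (p m L).[t].
    apply: (@le_trans _ _ (p m L).[(1 + m.+1%:R^-1) * t]); last first.
      by apply: horner_scale_le => //; [exact: p_size | have [+ _ _] := pP m; move=> + i; apply].
    have st0 : 0 <= (1 + m.+1%:R^-1) * t by rewrite mulr_ge0// (le_trans _ em).
    have [_ _ <-//] := pP m; apply: le_vol.
    - by apply: compact_parallel_body; have [] := ccL.
    - by have [] := ccx_addsegs [seq ((1 + m.+1%:R^-1) * t) *: v | v <- vs m] ccL.
    - by apply: parallel_addsegs; have [] := vsP m.
  have := p_le m _ _ ccL t0.
  have : 1 <= e m by rewrite exprn_ege1.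
  by move: (e m) (pvol L t) => E P; nra.
apply: (@squeeze_cvgr _ _ _ _ (fun m => pvol L t - (e m - 1) * pvol L t) (fun=> pvol L t)).
- by near=> m; rewrite le_p p_le.
- have /(cvgMr_tmp (b := pvol L t)) : e m - 1 @[m --> \oo] --> (1 - 1 : R).
    by apply: cvgB => //; exact: cvg_cst.
  rewrite subrr mul0r => h; rewrite -[X in _ --> X]subr0.
  by apply: cvgB => //; exact: cvg_cst.
- exact: cvg_cst.
Unshelve. all: by end_near. Qed.

(** A pointwise limit of polynomials of degree at most [n] is the polynomial found by interpolation,
    and the sign and monotonicity of the coefficients survive the limit. *)
Lemma steiner L : ccx L ->
  [/\ forall t, 0 <= t -> pvol L t = \sum_(k < n.+1) interp (pvol L) k * t ^+ k,
      forall k : 'I_n.+1, 0 <= interp (pvol L) k &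
      forall M (k : 'I_n.+1), ccx M -> L `<=` M -> interp (pvol L) k <= interp (pvol M) k].
Proof.
move=> ccL; have [p [p0 pS psz pcvg]] := pvol_approx.
have coef_cvg K (k : 'I_n.+1) : ccx K ->
    (p m K)`_k @[m --> \oo] --> interp (pvol K) k.
  move=> ccK; rewrite (_ : (fun m => _) = fun m => interp (horner (p m K)) k).
    by apply: interp_cvg => t t0; exact: pcvg.
  by apply/funext => m; rewrite interp_horner// psz.
split=> [t t0|k|M k ccM LM].
- apply: (@cvg_unique _ (@norm_hausdorff R R^o) _ _ _ _ (pcvg L t ccL t0)).
  rewrite (_ : (fun m => _) = fun m => \sum_(k < n.+1) (p m L)`_k * t ^+ k).
    apply: cvg_big => [|k _]; first exact: add_continuous.
    by apply: cvgMr_tmp; exact: coef_cvg.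
  by apply/funext => m; rewrite (horner_coef_wide _ (psz m L ccL)).
- apply: (cvgr_to_ge (coef_cvg L k ccL)).
  by near=> m; exact: p0.
- apply: (ler_cvg_to (coef_cvg L k ccL) (coef_cvg M k ccM)).
  by near=> m; exact: pS.
Unshelve. all: by end_near. Qed.

(** Uniqueness: whichever [W] the choice operator in [quermassintegral] returns, its values up to
    index [n] are forced. *)
Lemma steiner_formulaP L (W : nat -> R) (k : 'I_n.+1) : compact L ->
  steiner_formula L W -> interp (pvol L) k = 'C(n, k)%:R * W k.
Proof.
move=> cL sW; pose q := \poly_(i < n.+1) ('C(n, i)%:R * W i).
rewrite (@eq_interp _ _ _ (horner q)) => [|t t0].
  by rewrite interp_horner ?size_poly// coef_poly ltn_ord.
by rewrite /pvol /vol (sW _ t0)/= horner_poly.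
Qed.

Lemma quermassintegralE L (k : 'I_n.+1) : ccx L ->
  quermassintegral L k = interp (pvol L) k / 'C(n, k)%:R.
Proof.
move=> ccL; have [cL _] := ccL; have [SE _ _] := steiner ccL.
have C0 (i : 'I_n.+1) : 'C(n, i)%:R != 0 :> R.
  by rewrite pnatr_eq0 -lt0n bin_gt0 -ltnS.
(* The default 0 is taken beyond [n], where Steiner's formula does not look. *)
pose W i : R := if insub i is Some k' then interp (pvol L) (k' : 'I_n.+1) / 'C(n, i)%:R else 0.
have sW : steiner_formula L W.
  move=> t t0; rewrite volE; last exact: compact_parallel_body.
  congr EFin; rewrite -/(pvol L t) SE//; apply: eq_bigr => i _.
  by rewrite /W valK; congr (_ * _); rewrite mulrC divfK.
have := xgetPex (fun=> 0) (ex_intro (fun W' => steiner_formula L W') W sW).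
by move=> /(steiner_formulaP k cL) ->; rewrite mulrC mulKf.
Qed.

Lemma quermassintegral_ge0 L (k : 'I_n.+1) : ccx L -> 0 <= quermassintegral L k.
Proof.
by move=> ccL; have [_ h _] := steiner ccL; rewrite quermassintegralE// divr_ge0.
Qed.

Lemma le_quermassintegral L M (k : 'I_n.+1) : ccx L -> ccx M -> L `<=` M ->
  quermassintegral L k <= quermassintegral M k.
Proof.
move=> ccL ccM LM; have [_ _ h] := steiner ccL.
by rewrite !quermassintegralE// ler_wpM2r// h.
Qed.

Lemma ccx_affine c b L : 0 <= c -> ccx L -> ccx [set c *: x + b | x in L].
Proof.
move=> c0 [cL /convex_setE vL]; split.
  apply: continuous_compact => //.
  by apply: continuous_subspaceT; exact: (@continuous_affine R V).
apply/convex_setE => _ _ t [x Lx <-] [y Ly <-] t01.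
exists (t *: x + (1 - t) *: y); first exact: vL.
by apply/rowP => i; rewrite !mxE; ring.
Qed.

Lemma quermassintegral_affine c b L (k : 'I_n.+1) : 0 < c -> ccx L ->
  quermassintegral [set c *: x + b | x in L] k =
  c ^+ (n - k) * quermassintegral L k.
Proof.
move=> c0 ccL; have ccL' := ccx_affine b (ltW c0) ccL.
rewrite !quermassintegralE// mulrA; congr (_ / _).
have [SE _ _] := steiner ccL.
pose q := \poly_(i < n.+1) (c ^+ (n - i) * interp (pvol L) (inord i : 'I_n.+1)).
rewrite (@eq_interp _ _ _ (horner q)) => [|t t0].
  by rewrite interp_horner ?size_poly// coef_poly ltn_ord inord_val.
(* The parallel body of [c L + b] at distance [t] is the affine image of the one of [L] at distance
   [t / c]; comparing coefficients yields the degree [n - k]. *)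
have -> : pvol [set c *: x + b | x in L] t = c ^+ n * pvol L (t / c).
  rewrite -(vol_affine b c0); last by apply: compact_parallel_body; have [] := ccL.
  congr vol; apply/seteqP; split.
    move=> _ [_ [x Lx <-] [z Bz <-]]; exists (x + (t / c) *: z).
      by exists x => //; exists z.
    by rewrite scalerDr scalerA mulrC divfK ?gt_eqF// addrAC.
  move=> _ [_ [x Lx [z Bz <-]] <-]; exists (c *: x + b); first by exists x.
  exists z => //.
  by rewrite scalerDr scalerA mulrC divfK ?gt_eqF// addrAC.
rewrite SE ?divr_ge0 ?(ltW c0)// horner_poly mulr_sumr; apply: eq_bigr => i _.
have -> : c ^+ n = c ^+ (n - i) * c ^+ i by rewrite -exprD subnK// -ltnS.
rewrite inord_val expr_div_n; set X := c ^+ i; set Y := c ^+ (n - i).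
have X0 : X != 0 by rewrite expf_neq0 ?gt_eqF.
by field.
Qed.

End steiner.

(** * Symmetric convex bodies *)

Section convex_hull.
Context {R : realType} {n : nat}.
Local Notation V := 'rV[R]_n.
Implicit Types (A B K : set V) (x y z u : V) (s : seq V) (t : R).

Lemma convex_convex_hull A : convex_set (convex_hull A).
Proof.
apply/convex_setE => x y t Ax Ay t01 B [cB AB].
move/convex_setE : (cB); apply => //; first exact: Ax.
exact: Ay.
Qed.

Lemma sub_convex_hull A : A `<=` convex_hull A.
Proof. by move=> x Ax B [_]; apply. Qed.

Lemma convex_hull_min A B : convex_set B -> A `<=` B -> convex_hull A `<=` B.
Proof. by move=> cB AB x; apply. Qed.

Lemma convex_hullS A B : A `<=` B -> convex_hull A `<=` convex_hull B.
Proof.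
move=> AB; apply: convex_hull_min; first exact: convex_convex_hull.
exact: subset_trans AB (@sub_convex_hull B).
Qed.

Definition cone_over x A : set V :=
  [set z | exists2 y, A y & exists2 t, 0 <= t <= 1 & z = t *: x + (1 - t) *: y].

Lemma ccx_cone_over x A : ccx A -> ccx (cone_over x A).
Proof.
move=> [cA /convex_setE vA]; split.
  rewrite (_ : cone_over x A =
      (fun p : V * R => p.2 *: x + (1 - p.2) *: p.1) @` (A `*` `[0, 1])).
    apply: continuous_compact.
      by apply: continuous_subspaceT; exact: (@continuous_join R V).
    by apply: compact_setX => //; exact: segment_compact.
  apply/seteqP; split=> z.
    by move=> [y Ay [t t01 ->]]; exists (y, t) => //; split => //=; rewrite in_itv.
  move=> [[y t] /= [Ay]]; rewrite in_itv/= => t01 <-.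
  by exists y => //; exists t.
apply/convex_setE => _ _ l [y Ay [a /andP[a0 a1] ->]] [z Az [b /andP[b0 b1] ->]].
move=> /andP[l0 l1].
pose c := l * a + (1 - l) * b; pose d1 := l * (1 - a); pose d2 := (1 - l) * (1 - b).
have d10 : 0 <= d1 by rewrite mulr_ge0// subr_ge0.
have d20 : 0 <= d2 by rewrite mulr_ge0// subr_ge0.
have c0 : 0 <= c by rewrite addr_ge0// mulr_ge0// subr_ge0.
have cd : 1 - c = d1 + d2 by rewrite /c /d1 /d2; ring.
have -> : l *: (a *: x + (1 - a) *: y) + (1 - l) *: (b *: x + (1 - b) *: z) =
    c *: x + (d1 *: y + d2 *: z).
  by apply/rowP => i; rewrite !mxE /c /d1 /d2; ring.
have c01 : 0 <= c <= 1 by rewrite c0 -subr_ge0 cd addr_ge0.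
(* If both weights vanish the point is the apex [x], and any base point serves. *)
have [d0|d_neq0] := eqVneq (d1 + d2) 0.
  exists y => //; exists c; rewrite // cd d0 scale0r.
  have -> : d1 = 0 by lra.
  have -> : d2 = 0 by lra.
  by rewrite !scale0r addr0.
have d0 : 0 < d1 + d2 by rewrite lt_neqAle eq_sym d_neq0 addr_ge0.
exists ((d1 / (d1 + d2)) *: y + (1 - d1 / (d1 + d2)) *: z).
  apply: vA => //; apply/andP; split; first by rewrite divr_ge0// ltW.
  by rewrite ler_pdivrMr// mul1r lerDl.
exists c => //; rewrite cd; congr (_ + _).
by apply/rowP => i; rewrite !mxE; field.
Qed.

(** Adding a point to a nonempty finite set turns its hull into a cone over it. The induction starts
    at singletons, because a cone over the empty set misses its apex. *)
Lemma ccx_convex_hull s : ccx (convex_hull [set` s]).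
Proof.
case: s => [|x s].
  rewrite (_ : convex_hull _ = set0).
    by split; [exact: compact0 | move=> x y t; rewrite inE].
  by apply/seteqP; split => //; apply: convex_hull_min => // x y t; rewrite inE.
elim: s x => [|y s IH] x.
  rewrite (_ : convex_hull _ = [set x]); first exact: ccx_set1.
  apply/seteqP; split => [|_ ->]; last by apply: sub_convex_hull; rewrite /= inE.
  apply: convex_hull_min; first by have [] := ccx_set1 x.
  by move=> z /=; rewrite inE => /eqP.
have ccH := IH y; set H := convex_hull [set` y :: s] in ccH.
rewrite (_ : convex_hull _ = cone_over x H); first exact: ccx_cone_over.
apply/seteqP; split.
  apply: convex_hull_min; first by have [] := ccx_cone_over x ccH.
  move=> z /=; rewrite inE => /predU1P[->|zs].
    exists y; first by apply: sub_convex_hull; rewrite /= inE eqxx.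
    by exists 1; rewrite ?lexx ?ler01// subrr scale1r scale0r addr0.
  exists z; first exact: sub_convex_hull.
  by exists 0; rewrite ?lexx ?ler01// subr0 scale1r scale0r add0r.
move=> _ [z Hz [t t01 ->]].
have /convex_setE := @convex_convex_hull [set` x :: y :: s]; apply => //.
  by apply: sub_convex_hull; rewrite /= inE eqxx.
by apply: convex_hullS Hz => w /= ws; rewrite inE ws orbT.
Qed.

Lemma continuous_dot u : continuous (dot u : V -> R).
Proof.
pose g (i : 'I_n) (r : R) := u 0 i * r.
apply: (@continuous_sum_coord _ _ g) => i r.
by apply: cvgMl_tmp; exact: cvg_id.
Qed.

(* The first implication compares support functions: it says that the convex hull
   of [ps] contains [g + (d + h) K]. *)
Lemma convex_hull_perturb K g d h (ps s : seq V) :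
  compact K -> centrally_symmetric K -> K !=set0 -> 0 < d -> 0 < h ->
  (forall u M, (forall p, p \in ps -> dot u p < M) ->
     forall k, K k -> dot u (g + (d + h) *: k) < M) ->
  (forall p, p \in ps -> exists2 k, K k & h *: k + p \in s) ->
  [set d *: k + g | k in K] `<=` convex_hull [set` s].
Proof.
move=> cK sK K0 d0 h0 Hps Hs _ [k Kk <-]; apply: contrapT => nH.
have [u uP] := separation (ccx_convex_hull s) nH.
have [|k0 Kk0 kmax] := @EVT_max_rV R n (dot u) K K0 cK.
  by apply: continuous_subspaceT; exact: continuous_dot.
rewrite inE in Kk0.
have {}kmax x : K x -> dot u x <= dot u k0 by move=> Kx; apply: kmax; rewrite inE.
(* By symmetry, moving [p] by [h *: kp] lowers [dot u] by at most [h * dot u k0]. So all of [ps]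
   would lie strictly below the value of [dot u] at [g + (d + h) *: k0], against the hypothesis on
   [ps]. *)
suff /(Hps u _)/(_ _ Kk0) : forall p, p \in ps ->
    dot u p < (d + h) * dot u k0 + dot u g by rewrite dotDr dotZr addrC ltxx.
move=> p /Hs[kp Kkp xs].
have := uP _ (sub_convex_hull xs); rewrite !dotDr !dotZr.
have : dot u (- kp) <= dot u k0 by apply/kmax/sK.
have := kmax _ Kk; rewrite dotNr; nra.
Qed.

End convex_hull.

(** * Symmetric convex bodies and bases with almost maximal determinant *)

Section symmetric_body.
Context {R : realType} {n : nat}.
Local Notation V := 'rV[R]_n.
Variable K : set V.
Hypotheses (bK : convex_body K) (sK : centrally_symmetric K).
Implicit Types (x y : V) (a b : R).

Let cK : compact K. Proof. by have [] := bK. Qed.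

Let vK x y t : K x -> K y -> 0 <= t <= 1 -> K (t *: x + (1 - t) *: y).
Proof. by have [_ /convex_setE + _] := bK; apply. Qed.

Lemma symmetric_body0 : K 0.
Proof.
have [_ _ [x /interior_subset Kx]] := bK.
have := vK (t := 2^-1) Kx (sK Kx); rewrite scalerN -scalerBl.
rewrite (_ : 2^-1 - _ = 0) ?scale0r; last by field.
by apply; lra.
Qed.

Lemma symmetric_body_comb x y a b : K x -> K y -> 0 <= a -> 0 <= b -> a + b <= 1 ->
  K (a *: x + b *: y).
Proof.
move=> Kx Ky a0 b0 ab; have K0 := symmetric_body0.
have [b00|b_neq0] := eqVneq b 0.
  have := vK (t := a) Kx K0; rewrite b00 scale0r scaler0; apply.
  by apply/andP; split; lra.
have {}b0 : 0 < b by rewrite lt_neqAle eq_sym b_neq0.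
have a1 : 0 < 1 - a by lra.
have Ky' : K ((b / (1 - a)) *: y).
  have := vK (t := b / (1 - a)) Ky K0; rewrite scaler0 addr0; apply.
  by apply/andP; split; [apply: divr_ge0; lra | rewrite ler_pdivrMr// mul1r; lra].
have := vK (t := a) Kx Ky'; rewrite scalerA mulrCA divff ?gt_eqF// mulr1; apply.
by apply/andP; split; lra.
Qed.

Lemma symmetric_body_nbhs0 : exists2 e, 0 < e & forall i, K (e *: delta_mx 0 i).
Proof.
have [_ _ [x]] := bK.
move=> /nbhs_ballP[e /= e0 xK].
have e2 : 0 < e / 2 by rewrite divr_gt0.
have inK c i : `|c| < e -> K (x + c *: delta_mx 0 i).
  move=> ce; apply: xK; split=> // k j; rewrite /ball/= ord1 !mxE.
  rewrite opprD addNKr normrN normrM.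
  apply: le_lt_trans ce; rewrite ler_piMr//.
  by case: (_ && _); rewrite ?normr1// normr0.
exists (e / 2) => // i.
have ec : `|e / 2| < e by rewrite gtr0_norm//; lra.
have h1 := inK _ i ec; have := inK (- (e / 2)) i; rewrite normrN => /(_ ec) /sK h2.
(* Midpoint of a point near [x] and the reflection of its mirror image about [x]: the centre [x]
   cancels. *)
have := vK (t := 2^-1) h1 h2.
have -> : 2^-1 *: (x + (e / 2) *: delta_mx 0 i) +
    (1 - 2^-1) *: - (x + - (e / 2) *: delta_mx 0 i) = (e / 2) *: delta_mx 0 i.
  by apply/rowP => j; rewrite !mxE; field.
by apply; lra.
Qed.

Definition body_dets : set R :=
  [set `|\det E| | E in [set E : 'M[R]_n | forall i, K (row i E)]].

Lemma has_sup_body_dets : has_sup body_dets.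
Proof.
split.
  exists `|\det (0 : 'M[R]_n)|, 0 => // i; rewrite row0.
  exact: symmetric_body0.
have [M M0 KM] := compact_cube cK.
exists (\sum_(s : {perm 'I_n}) M ^+ n) => _ [E EK <-].
apply: le_trans (ler_norm_sum _ _ _) _; apply: ler_sum => s _.
rewrite normrM normr_sign mul1r normr_prod -[n in M ^+ n]card_ord -prodr_const.
apply: ler_prod => i _; rewrite normr_ge0 ler_norml.
by have := KM _ (EK i) (s i); rewrite mxE.
Qed.

(** Cramer's rule: expand along the replaced row, whose cofactors are those of [E]. *)
Lemma cramer_row (E : 'M[R]_n) x i :
  (x *m \adj E) 0 i = \det (\matrix_(k, j) (if k == i then x 0 j else E k j)).
Proof.
rewrite (expand_det_row _ i) mxE; apply: eq_bigr => j _.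
rewrite !mxE eqxx; congr (_ * _); rewrite /cofactor; congr (_ * \det _).
by apply/matrixP => k l; rewrite !mxE eq_sym (negPf (neq_lift _ _)).
Qed.

(* Rows almost maximizing the determinant: an Auerbach basis up to a factor 2. *)
Lemma near_auerbach : exists E : 'M[R]_n, (forall i, K (row i E)) /\
  forall x, K x -> exists2 a : 'rV[R]_n, (forall i, `|a 0 i| <= 2) & x = a *m E.
Proof.
have hs := has_sup_body_dets.
have [e e0 eK] := symmetric_body_nbhs0.
have sup0 : 0 < sup body_dets.
  apply: (@lt_le_trans _ _ `|\det (e%:M : 'M[R]_n)|).
    by rewrite det_scalar normr_gt0 expf_neq0// gt_eqF.
  apply: sup_upper_bound => //; exists e%:M => // i.
  by rewrite -scalemx1 linearZ/= row1.
have [_ [E EK <-] Esup] := sup_adherent (divr_gt0 sup0 (ltr0n R 2)) hs.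
have E0 : 0 < `|\det E| by lra.
have Eu : E \in unitmx by rewrite unitmxE unitfE -normr_gt0.
exists E; split => // x Kx; exists (x *m invmx E); last by rewrite mulmxKV.
move=> i; rewrite /invmx Eu -scalemxAr mxE cramer_row normrM normfV.
rewrite mulrC ler_pdivrMr//.
(* The coordinate of [x] is [\det E' / \det E]. The rows of [E'] are again in [K], so the numerator
   is at most the supremum, and the denominator exceeds half of it. *)
set E' := \matrix_(k, j) _.
have : `|\det E'| <= sup body_dets.
  apply: sup_upper_bound => //; exists E' => // k.
  have [->|ki] := eqVneq k i.
    by rewrite (_ : row _ _ = x)//; apply/rowP => j; rewrite !mxE eqxx.
  by rewrite (_ : row _ _ = row k E)//; apply/rowP => j; rewrite !mxE (negPf ki).
lra.
Qed.

End symmetric_body.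

(** * The lower bound *)

Section simplex.
Context {R : realType} {n : nat}.
Local Notation V := 'rV[R]_n.

(** With [q = 1 / (n + 1)], this makes [4 * r = q ^+ 2]: barycentric weights [q], changed by at most
    [q ^+ 2], stay nonnegative, and [n] of them have sum at most [1 - q ^+ 2]. *)
Definition simplex_radius : R := (4 * n.+1%:R ^+ 2)^-1.

Lemma simplex_radius_gt0 : 0 < simplex_radius.
Proof. by rewrite invr_gt0 mulr_gt0// exprn_gt0. Qed.

(* Half the vectors of a near-Auerbach basis, together with the origin. *)
Lemma inner_simplex (K : set V) : convex_body K -> centrally_symmetric K ->
  exists (P : nat -> V) g,
    (forall i k, K k -> K ((simplex_radius / 2) *: k + P i)) /\
    forall u M, (forall i, (i <= n)%N -> dot u (P i) < M) ->
    forall k, K k ->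
      dot u (g + (simplex_radius / 2 + simplex_radius / 2) *: k) < M.
Proof.
move=> bK sK; have [E [EK span]] := near_auerbach bK sK.
have r0 := simplex_radius_gt0; set r := simplex_radius in r0 *.
pose q : R := n.+1%:R^-1.
have q0 : 0 < q by rewrite invr_gt0.
have q1 : q <= 1 by rewrite invf_le1// ler1n.
have nq : n%:R * q = 1 - q.
  have -> : n%:R = n.+1%:R - 1 :> R by rewrite -natr1 addrK.
  by rewrite mulrBl mul1r divff ?pnatr_eq0.
have rE : 4 * r = q ^+ 2 by rewrite /r /simplex_radius invfM mulrA divff ?mul1r ?exprVn.
have qq : q ^+ 2 <= q by rewrite expr2 ler_piMl// ltW.
have K0 := symmetric_body0 bK sK.
pose P i : V := if i is i'.+1 then
  (if insub i' is Some k then 2^-1 *: row (k : 'I_n) E else 0) else 0.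
(* The barycentre of the simplex; the vertex 0 carries the remaining weight [q]. *)
exists P, (\sum_i q *: (2^-1 *: row i E)); split=> [i k Kk|u M PM k Kk].
  have half x : K x -> K ((r / 2) *: k + 2^-1 *: x).
    by move=> Kx; apply: (symmetric_body_comb bK sK); rewrite //; lra.
  have half0 : K ((r / 2) *: k + 0) by have := half _ K0; rewrite scaler0.
  case: i => [|i] //=; case: insubP => [i' _ _|_] //.
  by apply: half; exact: EK.
(* The origin is a vertex, so [M] is positive and weights of sum less than 1 suffice below. *)
have M0 : 0 < M by have := PM 0%N (leq0n n); rewrite /= dot0r.
have EM i : dot u (2^-1 *: row i E) < M.
  by have := PM i.+1 (ltn_ord i); rewrite /P valK.
have [a a2 ->] := span k Kk.
(* Since [|a 0 i| <= 2], each coordinate relative to the half basis vectors differs from [q] by at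
   most [4 * r]. *)
have -> : \sum_i q *: (2^-1 *: row i E) + (r / 2 + r / 2) *: (a *m E) =
    \sum_i (q + 2 * r * a 0 i) *: (2^-1 *: row i E).
  rewrite mulmx_sum_row scaler_sumr -big_split/=; apply: eq_bigr => i _.
  by apply/rowP => j; rewrite !mxE; field.
rewrite dot_sumr.
have b0 i : 0 <= q + 2 * r * a 0 i.
  by have := a2 i; rewrite ler_norml => /andP[h1 h2]; nra.
apply: (@le_lt_trans _ _ (\sum_(i < n) (q + 2 * r * a 0 i) * M)).
  by apply: ler_sum => i _; rewrite dotZr ler_wpM2l// ltW.
rewrite -mulr_suml gtr_pMl//.
apply: (@le_lt_trans _ _ (\sum_(i < n) (q + 4 * r))).
  apply: ler_sum => i _.
  by have := a2 i; rewrite ler_norml => /andP[h1 h2]; nra.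
rewrite sumr_const card_ord -(mulr_natl _ n) mulrDr nq rE.
have -> : n%:R * q ^+ 2 = (1 - q) * q by rewrite -nq; ring.
nra.
Qed.

End simplex.

(** * Lower bounds for iterated integrals on products of sets *)

Section lower_bound_of_integrals.
Context {R : realType}.
Local Open Scope ereal_scope.

(* [f] is not assumed measurable: the integral of a nonnegative function is a
   supremum over the simple functions below it. *)
Lemma integral_ge_on d (T : measurableType d) (mu : {measure set T -> \bar R})
    (D A : set T) (f : T -> \bar R) (c : R) :
  measurable A -> A `<=` D -> (0 <= c)%R -> (forall x, 0 <= f x) ->
  (forall x, A x -> c%:E <= f x) ->
  c%:E * mu A <= \int[mu]_(x in D) f x.
Proof.
move=> mA AD c0 f0 fA; rewrite integral_mkcond ge0_integralTE; last first.
  by move=> x; apply: erestrict_ge0.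
pose h := scale_nnsfun (indic_nnsfun R mA) c0.
apply: ereal_sup_ubound; exists h => [x|].
  rewrite /= /h/= /mindic indicE; case: (boolP (x \in A)) => xA.
    rewrite mulr1 patchE mem_set; first by apply: fA; rewrite inE in xA.
    by apply: AD; rewrite inE in xA.
  by rewrite mulr0; apply: erestrict_ge0.
by rewrite sintegralrM sintegral_indic// setIT.
Qed.

Lemma iterated_integral_ge0 n (K : set 'rV[R]_n) N (f : N.-tuple 'rV[R]_n -> \bar R) :
  (forall x, 0 <= f x) -> 0 <= iterated_integral K f.
Proof.
elim: N f => [|N IH] f f0 /=; first exact: f0.
by apply: integral_ge0 => x _; exact: IH.
Qed.

(** For a first point in [A 0] the inner integral is at least [v ^+ N * c], by induction with the
    sets shifted by one; this constant is then integrated over [A 0]. *)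
Lemma iterated_integral_ge n (K : set 'rV[R]_n) (v c : R) N
    (A : nat -> set 'rV[R]_n) (f : N.-tuple 'rV[R]_n -> \bar R) :
  (forall i, measurable (A i : set (rVBorel R n))) -> (forall i, A i `<=` K) ->
  (forall i, volume (A i) = v%:E) -> (0 <= v)%R -> (0 <= c)%R ->
  (forall x, 0 <= f x) ->
  (forall x : N.-tuple 'rV[R]_n, (forall i : 'I_N, A i (tnth x i)) -> c%:E <= f x) ->
  (v ^+ N * c)%:E <= iterated_integral K f.
Proof.
move=> + + + v0 c0; elim: N A f => [|N IH] A f mA AK vA f0 fA /=.
  by rewrite expr0 mul1r; apply: fA => -[].
rewrite (_ : v ^+ N.+1 * c = v ^+ N * c * v)%R; last by rewrite exprS; ring.
rewrite EFinM -(vA 0%N).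
apply: integral_ge_on => //.
- by rewrite mulr_ge0// exprn_ge0.
- by move=> x; apply: iterated_integral_ge0.
move=> x A0x.
apply: (IH (fun i => A i.+1)) => // xs Axs; apply: fA => i.
by case: (unliftP ord0 i) => [k ->|->//]; rewrite tnthS; exact: Axs.
Qed.

End lower_bound_of_integrals.

Theorem theorem1p5 (R : realType) (n N j : nat)
    (hj : (j < n)%N) (hN : (n.+1 <= N)%N) :
  exists2 c : R, 0 < c &
    forall K : set 'rV[R]_n, convex_body K -> centrally_symmetric K ->
      (c%:E * volume K ^+ N * (quermassintegral K j)%:E <=
       iterated_integral K (fun x : N.-tuple 'rV[R]_n =>
         (quermassintegral (convex_hull [set` x]) j)%:E))%E.
Proof.
have n0 : (0 < n)%N by exact: leq_ltn_trans hj.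
have jn : (j < n.+1)%N by exact: ltnW.
have r0 : 0 < @simplex_radius R n := simplex_radius_gt0.
(* One half of the radius is spent on moving the vertices, the other half is the size of the copy of
   [K] that remains in the hull. *)
pose h : R := @simplex_radius R n / 2.
have h0 : 0 < h by rewrite divr_gt0.
(* Each of the [N] copies of [h K] contributes [h ^+ n] through its volume, and homogeneity of
   degree [n - j] contributes the last factor. *)
exists ((h ^+ n) ^+ N * h ^+ (n - j)); first by rewrite mulr_gt0 ?exprn_gt0.
move=> K bK sK; have [cK vK K'0] := bK; have ccK : ccx K by split.
have [P [g [PK Pg]]] := inner_simplex bK sK.
pose A i := [set h *: k + P i | k in K].
have cA i : compact (A i) by have [] := ccx_affine (P i) (ltW h0) ccK.
have AK i : A i `<=` K by move=> _ [k Kk <-]; exact: PK.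
have vA i : volume (A i) = (h ^+ n * vol K)%:E.
  by rewrite volume_affine// volE.
rewrite volE// -EFin_expe -!EFinM.
have -> : (h ^+ n) ^+ N * h ^+ (n - j) * vol K ^+ N * quermassintegral K j =
    (h ^+ n * vol K) ^+ N * (h ^+ (n - j) * quermassintegral K j).
  by rewrite [(h ^+ n * vol K) ^+ N]exprMn; ring.
have W0 := quermassintegral_ge0 n0 (Ordinal jn).
apply: (iterated_integral_ge (fun i => compact_measurable_rV (cA i)) AK vA).
- by rewrite mulr_ge0 ?vol_ge0// exprn_ge0// ltW.
- by rewrite mulr_ge0 ?exprn_ge0 ?W0// ltW.
- by move=> x; rewrite lee_fin; apply: W0; exact: ccx_convex_hull.
move=> x Ax; rewrite lee_fin.
rewrite -(quermassintegral_affine n0 g (Ordinal jn) h0 ccK).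
apply: (le_quermassintegral n0 (Ordinal jn)).
- exact: ccx_affine (ltW h0) ccK.
- exact: ccx_convex_hull.
(* Only the points of index 0 to [n] serve as perturbed vertices; [hN] provides them, and further
   points can only enlarge the hull. *)
apply: (@convex_hull_perturb _ _ _ _ _ h [seq P i | i <- iota 0 n.+1]) => //.
- by exists 0; exact: symmetric_body0.
- move=> u M uM; apply: Pg => i ni; apply: uM; apply: map_f.
  by rewrite mem_iota add0n ltnS.
move=> _ /mapP[i +  ->]; rewrite mem_iota add0n => /= ni.
have iN : (i < N)%N by exact: leq_trans hN.
have [k Kk kE] := Ax (Ordinal iN).
by exists k => //; rewrite kE mem_tnth.
Qed.
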